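(* Let $G$ be a finite connected bipartite graph without loops and multiple edges with $\mathrm{ind}(G)\ge 2$, and let $d$ be a singular real root of $G$. Fix the positive principal eigenvector $y$ of $G$ used to define the standard vectors $y_\bullet,y_\circ$. Then there exists a standard representation $(\pi,f)$ of $G$ with dimension $d$, and it is unique up to unitary equivalence: if $(\pi,f)$ and $(\pi',f')$ are standard representations of $G$, both of dimension $d$, then $f=f'$ and $\pi,\pi'$ are unitarily equivalent.
   Context: Let $G$ be a finite connected graph without loops and multiple edges, with vertices $G_v=\{g_1,\dots,g_n\}$ and edge set $G_e$; $M(g)$ denotes the set of vertices adjacent to $g$. $\mathrm{ind}(G)$ is the largest eigenvalue of the adjacency matrix of $G$. The space $V_G$ consists of real vectors $x=(x_1,\dots,x_n)$ (''$G$-vectors''), identified with functions $G_v\to\mathbb{R}$, $x_i=x(g_i)$. For connected $G$ the eigenvalue $\mathrm{ind}(G)$ is simple and has an eigenvector $y\in V_G$ with all coordinates positive, the principal eigenvector (unique up to scaling). $G$ is bipartite: $G_v$ is a disjoint union of the odd vertices $\{g_1,\dots,g_p\}$ and the even vertices $\{g_{p+1},\dots,g_n\}$, every edge joining an odd and an even vertex. The odd standard vector is $y_\bullet=(y_1,\dots,y_p,0,\dots,0)$, the even standard vector is $y_\circ=(0,\dots,0,y_{p+1},\dots,y_n)$. For each $i$ let $\sigma_{g_i}:V_G\to V_G$ be the linear map with $(\sigma_{g_i}(x))_j=x_j$ for $j\ne i$ and $(\sigma_{g_i}(x))_i=-x_i+\sum_{j:\,g_j\in M(g_i)}x_j$.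 Put $\overset{\bullet}{c}=\sigma_{g_p}\cdots\sigma_{g_1}$ and $\overset{\circ}{c}=\sigma_{g_n}\cdots\sigma_{g_{p+1}}$. For $t>0$, $c_t=\cdots\overset{\bullet}{c}\,\overset{\circ}{c}\,\overset{\bullet}{c}$ is the alternating product of $t$ factors with rightmost factor $\overset{\bullet}{c}$; for $t<0$, $c_t=\cdots\overset{\circ}{c}\,\overset{\bullet}{c}\,\overset{\circ}{c}$ is the alternating product of $|t|$ factors with rightmost factor $\overset{\circ}{c}$; $c_0=\mathrm{id}$. Let $W$ be the group generated by all $\sigma_{g_i}$. For a vertex $a$ the simple root $\overline{a}\in V_G$ has $\overline a(a)=1$ and $\overline a(g)=0$ for $g\neq a$. A (real) root is a vector $w\overline a$ with $w\in W$, $a\in G_v$. A (coordinatewise) nonnegative $G$-vector $x$ is regular if $c_t(x)$ is nonnegative for all $t\in\mathbb{Z}$, and singular otherwise; so a singular root is in particular nonnegative. A representation $\pi$ of $G$ assigns to each vertex $a$ a separable Hilbert space $\pi(a)=H_a$ and to each edge joining $a$ and $b$ a pair of mutually adjoint bounded linear operators $\Gamma_{ab}:H_b\to H_a$, $\Gamma_{ba}=\Gamma_{ab}^*:H_a\to H_b$. It is locally scalar if for each vertex $g$ the operator $A_g=\sum_{b\in M(g)}\Gamma_{gb}\Gamma_{bg}$ is scalar, $A_g=\alpha_gI_{H_g}$ with $\alpha_g\ge 0$. A $G$-vector $f$ with $f(g)=\alpha_g\ge0$ for all $g\in G_v$ is called a character of $\pi$ (its values are determined by $\pi$ only at vertices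 with $H_g\ne0$; at vertices with $H_g=0$ any nonnegative value is allowed), and one considers pairs $(\pi,f)$. The dimension of $\pi$ is the $G$-vector $d(g)=\dim\pi(g)$. Representations $\pi,\pi'$ are unitarily equivalent if there are unitary operators $U_a:\pi(a)\to\pi'(a)$, $a\in G_v$, with $U_a\Gamma_{ab}=\Gamma'_{ab}U_b$ for all adjacent $a,b$. A character $f$ is standard if $f=c_t(y_\circ)$ or $f=c_t(y_\bullet)$ for some $t\in\mathbb{Z}$. A standard representation is a pair $(\pi,f)$ where $\pi$ is a locally scalar representation and $f$ is a character of $\pi$ which is standard. *)

(* Defs.v *)
From HB Require Import structures.
From mathcomp Require Import all_boot all_order all_algebra.
From mathcomp Require Import complex.
From mathcomp Require Import all_classical all_reals all_analysis.

Set Implicit Arguments.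
Unset Strict Implicit.
Unset Printing Implicit Defensive.

Import Order.TTheory GRing.Theory Num.Theory.
Import numFieldNormedType.Exports.

Local Open Scope classical_set_scope.
Local Open Scope ring_scope.

(* A graph is an adjacency relation [e] on ['I_n]; the vertex g_(i+1) is      *)
(* [i : 'I_n].  The odd vertices g_1, ..., g_p are the [i] with [i < p], the  *)
(* even ones are the others.  A G-vector is an element of ['rV[R]_n].         *)

Definition adjacency_mx (R : realType) (n : nat) (e : rel 'I_n) : 'M[R]_n :=
  \matrix_(i, j) (e i j)%:R.

(* For n > 0 the set of (real) eigenvalues of the symmetric adjacency matrix  *)
(* is finite and nonempty, so that the supremum is the largest eigenvalue.    *)
Definition graph_index (R : realType) (n : nat) (e : rel 'I_n) : R :=
  sup [set l : R | eigenvalue (adjacency_mx R e) l].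

Definition principal_eigenvector (R : realType) (n : nat) (e : rel 'I_n)
    (y : 'rV[R]_n) : Prop :=
  y *m adjacency_mx R e = graph_index R e *: y /\ forall i, 0 < y 0 i.

Section Reflections.
Variables (R : realType) (n p : nat) (e : rel 'I_n).

Definition odd_standard (y : 'rV[R]_n) : 'rV[R]_n :=
  \row_i (if (i < p)%N then y 0 i else 0).

Definition even_standard (y : 'rV[R]_n) : 'rV[R]_n :=
  \row_i (if (i < p)%N then 0 else y 0 i).

Definition sigma (i : 'I_n) (x : 'rV[R]_n) : 'rV[R]_n :=
  \row_j (if j == i then - x 0 i + \sum_(k | e i k) x 0 k else x 0 j).

(* [enum 'I_n] is increasing, and [foldl] applies the reflection of smallest  *)
(* index first: these are sigma_(g_p) ... sigma_(g_1) and                     *)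
(* sigma_(g_n) ... sigma_(g_(p+1)).                                           *)
Definition odd_coxeter (x : 'rV[R]_n) : 'rV[R]_n :=
  foldl (fun z i => sigma i z) x [seq i : 'I_n <- enum 'I_n | (i < p)%N].

Definition even_coxeter (x : 'rV[R]_n) : 'rV[R]_n :=
  foldl (fun z i => sigma i z) x [seq i : 'I_n <- enum 'I_n | (p <= i)%N].

(* The alternating product ... f2 f1 f2 f1 of k factors, the first one to be  *)
(* applied being f1.                                                          *)
Fixpoint alternating (f1 f2 : 'rV[R]_n -> 'rV[R]_n) (k : nat)
    (x : 'rV[R]_n) : 'rV[R]_n :=
  if k is k'.+1 then alternating f2 f1 k' (f1 x) else x.

Definition coxeter (t : int) : 'rV[R]_n -> 'rV[R]_n :=
  match t with
  | Posz k => alternating odd_coxeter even_coxeter k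
  | Negz k => alternating even_coxeter odd_coxeter k.+1
  end.

Inductive weyl : ('rV[R]_n -> 'rV[R]_n) -> Prop :=
| weyl_id : weyl id
| weyl_sigma i : weyl (sigma i)
| weyl_comp u v : weyl u -> weyl v -> weyl (u \o v)
| weyl_inv u v : weyl u -> cancel u v -> cancel v u -> weyl v.

Definition simple_root (a : 'I_n) : 'rV[R]_n := delta_mx 0 a.

Definition is_root (x : 'rV[R]_n) : Prop :=
  exists w a, weyl w /\ x = w (simple_root a).

Definition nonneg_vector (x : 'rV[R]_n) : Prop := forall i, 0 <= x 0 i.

Definition regular (x : 'rV[R]_n) : Prop :=
  nonneg_vector x /\ forall t, nonneg_vector (coxeter t x).

Definition singular (x : 'rV[R]_n) : Prop :=
  nonneg_vector x /\ ~ regular x.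

Definition standard_vector (y f : 'rV[R]_n) : Prop :=
  exists t, f = coxeter t (even_standard y) \/ f = coxeter t (odd_standard y).

End Reflections.

Record hilbertSpace (R : realType) := HilbertSpace {
  hilbert_sort :> completeNormedModType R[i];
  hdot : {dot hilbert_sort for Num.conj};
  hdot_norm : forall x : hilbert_sort, hdot x x = `|x| ^+ 2;
  hilbert_separable : exists D : set hilbert_sort, countable D /\ dense D }.

Definition adjoint_pair (R : realType) (H K : hilbertSpace R)
    (u : H -> K) (v : K -> H) : Prop :=
  forall x z, hdot K (u x) z = hdot H x (v z).

Definition unitary_operator (R : realType) (H K : hilbertSpace R)
    (u : H -> K) : Prop :=
  isometry (hdot K) (hdot H) u /\ bijective u.

Definition hilbert_dim (R : realType) (H : hilbertSpace R) (k : nat) : Prop :=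
  exists b : 'I_k -> H,
    (forall i j, hdot H (b i) (b j) = (i == j)%:R) /\
    (forall x : H, x = \sum_i hdot H x (b i) *: b i).

(* [rep_op pi a b] is Gamma_ab : H_b -> H_a.  It is meaningful only for       *)
(* adjacent [a] and [b]: its other values are never used.                     *)
Record representation (R : realType) (n : nat) (e : rel 'I_n) :=
  Representation {
    rep_space :> 'I_n -> hilbertSpace R;
    rep_op : forall a b, {linear rep_space b -> rep_space a};
    rep_bounded : forall a b, e a b ->
      bounded_near (rep_op a b) (nbhs (0 : rep_space b));
    rep_adjoint : forall a b, e a b ->
      adjoint_pair (rep_op a b) (rep_op b a) }.

Section Representations.
Variables (R : realType) (n p : nat) (e : rel 'I_n).
Implicit Types (pi : representation R e) (f d y : 'rV[R]_n).

Definition vertex_operator pi (g : 'I_n) (x : pi g) : pi g :=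
  \sum_(b | e g b) rep_op pi g b (rep_op pi b g x).

Definition locally_scalar pi : Prop :=
  forall g, exists alpha : R, 0 <= alpha /\
    forall x : pi g, vertex_operator x = (alpha%:C)%C *: x.

Definition is_character pi f : Prop :=
  forall g, 0 <= f 0 g /\
    forall x : pi g, vertex_operator x = ((f 0 g)%:C)%C *: x.

Definition has_dimension pi d : Prop :=
  forall g, exists k : nat, d 0 g = k%:R /\ hilbert_dim (pi g) k.

Definition standard_representation y pi f : Prop :=
  [/\ locally_scalar pi, is_character pi f & standard_vector p e y f].

Definition unitarily_equivalent pi pi' : Prop :=
  exists U : forall a, {linear pi a -> pi' a},
    (forall a, unitary_operator (U a)) /\
    (forall a b, e a b -> forall x : pi b,
       U a (rep_op pi a b x) = rep_op pi' a b (U b x)).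

End Representations.

(* Main.v *)
(* A singular real root d is brought down to a simple root by applying the two
   Coxeter maps alternately: real roots have a constant sign, so the first
   vector of the orbit of d which is not nonnegative comes from a simple root.
   On representations these maps are reflection functors: at every vertex g of
   one parity, H_g is embedded (up to the scalar f(g) > 0) in the sum of the
   spaces at the neighbours of g and is replaced by its orthogonal complement.
   This changes the dimension by the Coxeter map of that parity and the
   character by the other one.  The nonnegative standard characters are
   U_i y on one parity and U_(i+1) y on the other, where U_0 = 0, U_1 = 1 and
   U_(i+2) = ind(G) U_(i+1) - U_i; as ind(G) >= 2 the U_i increase, so the
   functors never meet a zero character on the way up from the simple root, and
   on the way down a zero character would force d = 0.  At the simple root the
   character has to vanish at its vertex, which determines it, and all the
   operators are zero. *)

From HB Require Import structures.
Require Import Defs.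
From mathcomp Require Import all_boot all_order all_algebra.
From mathcomp Require Import complex ring.
From mathcomp Require Import all_classical all_reals all_analysis.

Set Implicit Arguments.
Unset Strict Implicit.
Unset Printing Implicit Defensive.

Import Order.TTheory GRing.Theory Num.Theory.
Import numFieldNormedType.Exports.

Local Open Scope classical_set_scope.
Local Open Scope ring_scope.

(** * The Hilbert space C^k *)

(** The alias lets [C^k] carry the norm of the dot product instead of the maximum norm of
    matrices. *)
Definition euclid (R : realType) (k : nat) := 'rV[R[i]]_k.

Section Euclid.
Variables (R : realType) (k : nat).
Local Notation C := (R[i]).
Local Notation E := (euclid R k).

HB.instance Definition _ := GRing.Lmodule.copy E 'rV[C]_k.
HB.instance Definition _ := Vector.copy E 'rV[C]_k.

Definition euclid_dot (x y : E) : C := \sum_i x 0 i * (y 0 i)^*.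

Lemma euclid_dot_bilinear :
  bilinear_for ( *%R : C -> C -> C) (Num.conj \; *%R) euclid_dot.
Proof.
split=> u a x z /=; rewrite /euclid_dot mulr_sumr -big_split /=;
  apply: eq_bigr => i _; rewrite !mxE ?mulrDl ?mulrA //.
by rewrite rmorphD rmorphM mulrDr mulrCA mulrA.
Qed.

HB.instance Definition _ := bilinear_isBilinear.Build C E E C
  (GRing.Scale.Law.clone _ _ ( *%R ) _)
  (GRing.Scale.Law.clone _ _ (Num.conj \; *%R ) _)
  euclid_dot euclid_dot_bilinear.

Lemma euclid_dot_hermitian (x y : E) :
  euclid_dot x y = (-1) ^+ false * Num.conj (euclid_dot y x).
Proof.
rewrite expr0 mul1r /euclid_dot rmorph_sum; apply: eq_bigr => i _.
by rewrite rmorphM /= conjCK mulrC.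
Qed.

HB.instance Definition _ := @isHermitianSesquilinear.Build C E false
  Num.conj euclid_dot euclid_dot_hermitian.

Lemma euclid_dot_gt0 (x : E) : x != 0 -> 0 < euclid_dot x x.
Proof.
move=> x_neq0; have: exists i, x 0 i != 0.
  apply/existsP; apply: contraNT x_neq0; rewrite negb_exists => /forallP x0.
  by apply/eqP/rowP => i; rewrite mxE; apply/eqP; move: (x0 i); rewrite negbK.
case=> i xi; rewrite /euclid_dot (bigD1 i) //= ltr_pwDl //.
  by rewrite mul_conjC_gt0.
by apply: sumr_ge0 => j _; rewrite mul_conjC_ge0.
Qed.

HB.instance Definition _ := isDotProduct.Build C E euclid_dot euclid_dot_gt0.

Definition euclid_norm (x : E) : C := sqrtC (euclid_dot x x).

Lemma euclid_normD (x y : E) :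
  euclid_norm (x + y) <= euclid_norm x + euclid_norm y.
Proof. by have [] := triangle_lerif euclid_dot x y. Qed.

Lemma euclid_normZ (a : C) (x : E) : euclid_norm (a *: x) = `|a| * euclid_norm x.
Proof.
rewrite /euclid_norm dnormZ rootCMl ?exprn_ge0 //.
by rewrite sqrCK.
Qed.

Lemma euclid_norm_eq0 (x : E) : euclid_norm x = 0 -> x = 0.
Proof. by move/eqP; rewrite sqrt_dnorm_eq0 => /eqP. Qed.

HB.instance Definition _ := @Lmodule_isNormed.Build C E euclid_norm
  euclid_normD euclid_normZ euclid_norm_eq0.
End Euclid.

Local Notation Re := (@complex.Re _).
Local Notation Im := (@complex.Im _).

(** Radii of balls in a normed module over [R[i]] are complex numbers; this reduces them to real
    ones. *)
Lemma complex_gt0P (R : realType) (e : R[i]) :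
  0 < e -> exists2 r : R, 0 < r & e = (r%:C)%C.
Proof.
case: e => a b; rewrite ltcE /= => /andP[/eqP b0 a0].
by exists a => //; rewrite b0.
Qed.

(** * Completeness and separability of [C^k], boundedness of its linear maps *)

Section EuclidHilbert.
Variables (R : realType) (k : nat).
Local Notation C := (R[i]).
Local Notation E := (euclid R k).
Implicit Types x y : E.

Lemma euclid_dotE x y : euclid_dot x y = \sum_i x 0 i * (y 0 i)^*.
Proof. by []. Qed.

Lemma euclid_dot_norm x : euclid_dot x x = `|x| ^+ 2.
Proof. by rewrite /Num.norm /= /euclid_norm sqrtCK. Qed.

Lemma euclid_coord_le x i : `|x 0 i| <= `|x|.
Proof.
rewrite -(ler_pXn2r (n := 2)) ?nnegrE ?normr_ge0 // -euclid_dot_norm.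
rewrite normCK /euclid_dot (bigD1 i) //= lerDl.
by apply: sumr_ge0 => j _; rewrite mul_conjC_ge0.
Qed.

Definition euclid_basis (i : 'I_k) : E := delta_mx 0 i.

Lemma euclid_dot_basis x i : euclid_dot x (euclid_basis i) = x 0 i.
Proof.
rewrite /euclid_dot (bigD1 i) //= !mxE !eqxx rmorph1 mulr1 big1 ?addr0 // => j ji.
by rewrite !mxE (negbTE ji) andbF rmorph0 mulr0.
Qed.

Lemma euclid_sum_basis x : x = \sum_i x 0 i *: euclid_basis i.
Proof. exact: row_sum_delta. Qed.

Lemma euclid_norm_basis i : `|euclid_basis i| = 1.
Proof.
rewrite /Num.norm /= /euclid_norm euclid_dot_basis.
by rewrite mxE !eqxx sqrtC1.
Qed.

Lemma euclid_norm_le_sum x : `|x| <= \sum_i `|x 0 i|.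
Proof.
rewrite [X in `|X|]euclid_sum_basis (le_trans (ler_norm_sum _ _ _)) //.
by apply: ler_sum => i _; rewrite normrZ euclid_norm_basis mulr1.
Qed.

Lemma complex_norm_le (z : C) : `|z| <= (`|Re z| + `|Im z|)%:C%C.
Proof.
rewrite [z in `|z|]complexE (le_trans (ler_normD _ _)) // rmorphD /=.
rewrite normrM !normc_def /= !expr0n /= !addr0 add0r expr1n sqrtr1 mul1r.
by rewrite !sqrtr_sqr.
Qed.

Lemma complex_norm_ge_Im (z : C) : `|Im z|%:C%C <= `|z|.
Proof.
rewrite normc_def lecR -sqrtr_sqr ler_sqrt ?lerDr ?sqr_ge0 //.
by rewrite addr_ge0 ?sqr_ge0.
Qed.

Lemma euclid_norm_small (e : R) : 0 < e -> exists2 h : R, 0 < h &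
  forall x : E, (forall i, `|Re (x 0 i)| <= h /\ `|Im (x 0 i)| <= h) ->
  `|x| < e%:C%C.
Proof.
move=> e0; have k0 : 0 < 2 * k%:R + 1 :> R by rewrite ltr_wpDl // mulr_ge0.
(* The norm is at most the sum of the [2 * k] absolute values of real and imaginary parts; the [+ 1]
   makes the bound strict and the divisor nonzero for [k = 0]. *)
exists (e / (2 * k%:R + 1)) => [|x hx]; first by rewrite divr_gt0.
set h := e / _ in hx *.
apply: (@le_lt_trans _ _ ((h * (2 * k%:R))%:C%C)); last first.
  by rewrite ltcR /h mulrAC ltr_pdivrMr // ltr_pM2l // ltrDl.
have -> : (h * (2 * k%:R))%:C%C = \sum_(i < k) (h + h)%:C%C :> C.
  rewrite -(rmorph_sum (real_complex R)) /= sumr_const card_ord.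
  congr (_%:C)%C; rewrite -[RHS]mulr_natr; ring.
apply: le_trans (euclid_norm_le_sum x) _; apply: ler_sum => i _.
apply: le_trans (complex_norm_le _) _; have [hr hi] := hx i.
by rewrite lecR lerD.
Qed.

(** Functions that do not increase distances preserve Cauchy filters, so the completeness of the
    reals applies to the real and imaginary part of each coordinate. *)
Lemma euclid_lip_cauchy (g : E -> R) (F : set_system E) :
  (forall x y, `|g x - g y|%:C%C <= `|x - y|) -> ProperFilter F -> cauchy F ->
  exists l : R, forall e : R, 0 < e -> \forall x \near F, `|l - g x| < e.
Proof.
move=> g_lip FF Fc.
have gc : cauchy (g @ F).
  apply: cauchy_exP => e e0.
  have /cauchyP/(_ e%:C%C) [|x Fx] := Fc; first by rewrite ltcR.
  exists (g x); rewrite /nbhs /= -/(F (g @^-1` ball (g x) e)).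
  apply: filterS Fx => z; rewrite -!ball_normE /= => xz.
  by rewrite -ltcR; apply: le_lt_trans xz.
have /cvg_ex[l gl] : cvg (g @ F) by exact: R_complete.
by exists l => e e0; move/cvgrPdist_lt : gl => /(_ e e0).
Qed.

Lemma euclid_complete (F : set_system E) :
  ProperFilter F -> cauchy F -> cvg F.
Proof.
move=> FF Fc.
have /boolp.choice[a Ha] (i : 'I_k) : exists l : R, forall e : R, 0 < e ->
    \forall x \near F, `|l - Re ((x : E) 0 i)| < e.
  apply: euclid_lip_cauchy => // x y.
  apply: le_trans (euclid_coord_le _ i); rewrite !mxE.
  by rewrite (le_trans _ (normc_ge_Re _)) // raddfB.
have /boolp.choice[b Hb] (i : 'I_k) : exists l : R, forall e : R, 0 < e ->
    \forall x \near F, `|l - Im ((x : E) 0 i)| < e.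
  apply: euclid_lip_cauchy => // x y.
  apply: le_trans (euclid_coord_le _ i); rewrite !mxE.
  by rewrite (le_trans _ (complex_norm_ge_Im _)) // raddfB.
apply/cvg_ex; exists (\row_i Complex (a i) (b i) : E).
apply/cvgrPdist_lt => _ /complex_gt0P[e e0 ->].
have [h h0 hsmall] := euclid_norm_small e0.
have Ka : \forall x \near F, forall i, `|a i - Re ((x : E) 0 i)| < h.
  by apply: filter_forall => i; exact: Ha.
have Kb : \forall x \near F, forall i, `|b i - Im ((x : E) 0 i)| < h.
  by apply: filter_forall => i; exact: Hb.
near=> x; apply: hsmall => i; rewrite !mxE /= !raddfB /=.
by split; apply: ltW; move: i; near: x.
Unshelve. all: by end_near. Qed.

HB.instance Definition _ := Uniform_isComplete.Build E euclid_complete.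

Lemma euclid_separable : exists D : set E, countable D /\ dense D.
Proof.
pose g (q : 'rV[rat * rat]_k) : E :=
  \row_i (ratr (q 0 i).1 +i* ratr (q 0 i).2)%C.
exists (g @` setT); split.
  by apply: card_le_trans (card_image_le _ _) _; apply: countableP.
move=> O [x Ox] Oo; have : nbhs x O by exact: open_nbhs_nbhs.
rewrite -nbhs_ballE; case=> _ /complex_gt0P[e e0 ->] xO.
have [h h0 hsmall] := euclid_norm_small e0.
have approx (a : R) : exists q : rat, `|a - ratr q| <= h.
  have [|q] := @rat_in_itvoo R (a - h) (a + h).
    by rewrite ltrBlDr -addrA ltrDl addr_gt0.
  rewrite in_itv /= => /andP[q1 q2]; exists q.
  by rewrite distrC ler_distl !ltW.
have /boolp.choice[q1 Hq1] := fun i : 'I_k => approx (Re (x 0 i)).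
have /boolp.choice[q2 Hq2] := fun i : 'I_k => approx (Im (x 0 i)).
exists (g (\row_i (q1 i, q2 i))); split; last by exists (\row_i (q1 i, q2 i)).
apply: xO; rewrite -ball_normE /=; apply: hsmall => i; rewrite !mxE /= !raddfB /=.
by split; [exact: Hq1 | exact: Hq2].
Qed.

Definition euclid_hilbert : hilbertSpace R :=
  @HilbertSpace R E (@euclid_dot R k) euclid_dot_norm euclid_separable.

Lemma euclid_hilbert_dim : hilbert_dim euclid_hilbert k.
Proof.
exists euclid_basis; split=> [i j|x].
  by rewrite /= euclid_dot_basis mxE eqxx eq_sym.
rewrite [LHS]euclid_sum_basis; apply: eq_bigr => i _.
by rewrite /= euclid_dot_basis.
Qed.

Lemma euclid_linear_bounded (V : normedModType C) (g : {linear E -> V}) :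
  bounded_near g (nbhs (0 : E)).
Proof.
apply/linear_boundedP; near=> r => x.
rewrite [x in g x]euclid_sum_basis linear_sum.
rewrite (le_trans (ler_norm_sum _ _ _)) //.
apply: (@le_trans _ _ ((\sum_i `|g (euclid_basis i)|) * `|x|)).
  rewrite mulr_suml; apply: ler_sum => i _.
  by rewrite linearZ normrZ mulrC ler_wpM2l ?euclid_coord_le.
by rewrite ler_wpM2r //; near: r; apply: nbhs_pinfty_ge; rewrite ger0_real ?sumr_ge0.
Unshelve. all: by end_near. Qed.

End EuclidHilbert.

(** * Real roots *)

Section Roots.
Variables (R : realType) (n : nat) (e : rel 'I_n).
Hypotheses (e_sym : symmetric e) (e_irr : irreflexive e).
Local Notation V := 'rV[R]_n.
Local Notation sigma := (@sigma R n e).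
Local Notation alpha := (@simple_root R n).
Implicit Types (x z : V) (i j a t : 'I_n).

(** The simple coroot at [i] for the Cartan matrix [2 - A], with [A] the adjacency matrix; [sigma i]
    is its reflection. *)
Definition cartan_pairing i x : R := x 0 i *+ 2 - \sum_(k | e i k) x 0 k.

Lemma cartan_pairingD i x z :
  cartan_pairing i (x + z) = cartan_pairing i x + cartan_pairing i z.
Proof.
rewrite /cartan_pairing mxE mulrnDl.
under eq_bigr do rewrite mxE.
by rewrite big_split /= opprD addrACA.
Qed.

Lemma cartan_pairingZ i (c : R) x :
  cartan_pairing i (c *: x) = c * cartan_pairing i x.
Proof.
rewrite /cartan_pairing mxE -mulrnAr mulrBr mulr_sumr.
by under eq_bigr do rewrite mxE.
Qed.

Lemma cartan_pairing_simple i a :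
  cartan_pairing i (alpha a) = (i == a)%:R *+ 2 - (e i a)%:R.
Proof.
rewrite /cartan_pairing mxE eqxx; congr (_ - _).
rewrite -big_filter (eq_bigr (fun k => (k == a)%:R)); last first.
  by move=> k _; rewrite mxE eqxx.
rewrite big_filter; case: (boolP (e i a)) => ia.
  rewrite (bigD1 a) //= eqxx big1 ?addr0 // => k /andP[_ /negbTE->] //.
rewrite big1 // => k ik; case: eqP => // ka.
by rewrite -ka ik in ia.
Qed.

Lemma sigmaE i x : sigma i x = x - cartan_pairing i x *: alpha i.
Proof.
apply/rowP => j; rewrite !mxE eqxx /= eq_sym; case: eqP => [->|_].
  by rewrite mulr1 /cartan_pairing; ring.
by rewrite mulr0 subr0.
Qed.

Lemma sigmaD i x z : sigma i (x + z) = sigma i x + sigma i z.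
Proof. by rewrite !sigmaE cartan_pairingD scalerDl opprD addrACA. Qed.

Lemma sigmaZ i (c : R) x : sigma i (c *: x) = c *: sigma i x.
Proof. by rewrite !sigmaE cartan_pairingZ scalerBr scalerA. Qed.

Lemma sigma_simple i : sigma i (alpha i) = - alpha i.
Proof.
rewrite sigmaE cartan_pairing_simple eqxx e_irr subr0 scaler_nat.
by rewrite mulr2n opprD addrA subrr add0r.
Qed.

Lemma sigma_simple_adj i a : e i a -> sigma i (alpha a) = alpha a + alpha i.
Proof.
move=> ia; rewrite sigmaE cartan_pairing_simple ia.
have /negbTE-> : i != a by apply: contraTneq ia => ->; rewrite e_irr.
by rewrite mul0rn sub0r scaleN1r opprK.
Qed.

Lemma sigma_simple_far i a : i != a -> ~~ e i a -> sigma i (alpha a) = alpha a.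
Proof.
move=> /negbTE ia /negbTE nia.
by rewrite sigmaE cartan_pairing_simple ia nia mul0rn subr0 scale0r subr0.
Qed.

Lemma sigmaK i : involutive (sigma i).
Proof.
move=> x; rewrite [in X in sigma i X]sigmaE sigmaD -scaleNr sigmaZ sigma_simple.
by rewrite sigmaE scalerN scaleNr opprK addrNK.
Qed.

Lemma sigma_commute i j x : i != j -> ~~ e i j ->
  sigma i (sigma j x) = sigma j (sigma i x).
Proof.
move=> ij nij; have ji : j != i by rewrite eq_sym.
have nji : ~~ e j i by rewrite e_sym.
rewrite [in X in sigma i X]sigmaE [in X in sigma j X]sigmaE.
rewrite !sigmaD -!scaleNr !sigmaZ !sigma_simple_far //.
by rewrite !sigmaE -!scaleNr addrAC.
Qed.

Lemma sigma_braid i j x : e i j ->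
  sigma i (sigma j (sigma i x)) = sigma j (sigma i (sigma j x)).
Proof.
move=> ij; have ji : e j i by rewrite e_sym.
(* Both sides are the reflection in the root [alpha i + alpha j], and this formula is symmetric in
   the two vertices. *)
have half a b : e a b -> sigma a (sigma b (sigma a x)) =
    x - (cartan_pairing a x + cartan_pairing b x) *: (alpha a + alpha b).
  move=> ab; have ba : e b a by rewrite e_sym.
  rewrite [in X in sigma b X]sigmaE -scaleNr sigmaD sigmaZ.
  rewrite (sigma_simple_adj ba) [sigma b x]sigmaE -scaleNr !sigmaD !sigmaZ.
  rewrite sigmaD (sigma_simple_adj ab) sigma_simple.
  rewrite [sigma a x]sigmaE -!scaleNr.
  apply/rowP => k; rewrite !mxE; ring.
rewrite (half _ _ ij) (half _ _ ji).
by rewrite [cartan_pairing i x + _]addrC [alpha i + _]addrC.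
Qed.

(** The symmetric form of the Cartan matrix, on the diagonal twice the Tits form; the reflections
    preserve it. *)
Definition cartan_form x z : R := \sum_i x 0 i * cartan_pairing i z.

Lemma cartan_form_simple a z : cartan_form (alpha a) z = cartan_pairing a z.
Proof.
rewrite /cartan_form (bigD1 a) //= mxE !eqxx mul1r big1 ?addr0 // => i ia.
by rewrite mxE (negbTE ia) andbF mul0r.
Qed.

Lemma cartan_formC x z : cartan_form x z = cartan_form z x.
Proof.
rewrite /cartan_form /cartan_pairing.
under eq_bigr do rewrite mulrBr.
under [RHS]eq_bigr do rewrite mulrBr.
rewrite !big_split /=; congr (_ + _).
  by apply: eq_bigr => i _; ring.
rewrite !sumrN; congr (- _).
under eq_bigr do rewrite mulr_sumr big_mkcond.
under [RHS]eq_bigr do rewrite mulr_sumr big_mkcond.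
rewrite exchange_big; apply: eq_bigr => i _; apply: eq_bigr => j _.
by rewrite e_sym mulrC.
Qed.

Lemma cartan_formDl x1 x2 z :
  cartan_form (x1 + x2) z = cartan_form x1 z + cartan_form x2 z.
Proof.
by rewrite /cartan_form -big_split; apply: eq_bigr => i _; rewrite mxE mulrDl.
Qed.

Lemma cartan_formZl (c : R) x z : cartan_form (c *: x) z = c * cartan_form x z.
Proof.
by rewrite /cartan_form mulr_sumr; apply: eq_bigr => i _; rewrite mxE mulrA.
Qed.

Lemma cartan_form_sigma i x :
  cartan_form (sigma i x) (sigma i x) = cartan_form x x.
Proof.
rewrite sigmaE -scaleNr cartan_formDl cartan_formZl.
rewrite [cartan_form x _]cartan_formC [cartan_form (alpha i) (_ + _)]cartan_formC.
rewrite !cartan_formDl !cartan_formZl !(cartan_formC _ (alpha i)).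
rewrite !cartan_form_simple cartan_pairing_simple eqxx e_irr subr0.
rewrite -[true%:R]/(1%R : R).
ring.
Qed.

(** * Words in the reflections, their length, and the sign of roots *)

Definition word_act (s : seq 'I_n) x : V := foldl (fun z i => sigma i z) x s.

Lemma word_actD s x z : word_act s (x + z) = word_act s x + word_act s z.
Proof. by elim: s x z => //= i s IH x z; rewrite sigmaD IH. Qed.

Lemma word_actN s x : word_act s (- x) = - word_act s x.
Proof. by elim: s x => //= i s IH x; rewrite -scaleN1r sigmaZ scaleN1r IH. Qed.

Lemma word_act_cat s1 s2 x :
  word_act (s1 ++ s2) x = word_act s2 (word_act s1 x).
Proof. exact: foldl_cat. Qed.

Lemma word_act_revK s : cancel (word_act s) (word_act (rev s)).
Proof.
move=> x; elim: s x => //= i s IH x.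
by rewrite rev_cons -cats1 word_act_cat IH /= sigmaK.
Qed.

Lemma word_act_form s x :
  cartan_form (word_act s x) (word_act s x) = cartan_form x x.
Proof. by elim: s x => //= i s IH x; rewrite IH cartan_form_sigma. Qed.

(** Each reflection is an involution, so reversed words give the inverses. *)
Lemma weyl_word w : weyl e w -> exists s, w =1 word_act s.
Proof.
elim=> [|i|u v _ [su hu] _ [sv hv]|u v _ [s hs] uv vu].
- by exists [::].
- by exists [:: i].
- by exists (sv ++ su) => x; rewrite /= word_act_cat hu hv.
- exists (rev s) => x; rewrite -{1}[x](word_act_revK (rev s)) revK.
  by rewrite -hs uv.
Qed.

Definition reduced s := forall v, word_act v =1 word_act s -> (size s <= size v)%N.

(** The letter [a] in front acts first. For a reduced [s] with map [w], the condition says that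
    [w \o sigma a] is not shorter than [w]. *)
Definition ascent s a :=
  forall v, word_act v =1 word_act (a :: s) -> (size s <= size v)%N.

Lemma reduced_word s : exists2 v, word_act v =1 word_act s & reduced v.
Proof.
have [m] := ubnP (size s); elim: m s => // m IH s; rewrite ltnS => sm.
have [rs|nrs] := pselect (reduced s); first by exists s.
have [v [vs sv]] : exists v, word_act v =1 word_act s /\ (size v < size s)%N.
  apply: contrapT => nv; apply: nrs => v vs; rewrite leqNgt; apply/negP => sv.
  by apply: nv; exists v.
have [u uv ru] := IH v (leq_trans sv sm).
by exists u => // x; rewrite uv.
Qed.

(** As [sigma a] is an involution, a shorter word [v] for [a :: s] makes [a :: v] a word for [s];
    minimality of [s] fixes the length of [v] and makes it reduced. *)
Lemma descent_word s a : reduced s -> ~ ascent s a ->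
  exists v, [/\ word_act s =1 word_act (a :: v), reduced v & size s = (size v).+1].
Proof.
move=> rs nas.
have [v [vs sv]] : exists v, word_act v =1 word_act (a :: s) /\ (size v < size s)%N.
  apply: contrapT => nv; apply: nas => v vs; rewrite leqNgt; apply/negP => sv.
  by apply: nv; exists v.
have sE : word_act (a :: v) =1 word_act s by move=> x /=; rewrite vs /= sigmaK.
have ev : size s = (size v).+1 by apply/eqP; rewrite eqn_leq sv andbT; exact: rs sE.
exists v; split => // u uv.
by rewrite -ltnS -ev; apply: (rs (a :: u)) => x /=; rewrite uv -sE.
Qed.

(* In the simply laced case a dihedral subgroup has braid length 2 or 3, so that
   removing at most two letters from the word is enough for the induction. *)
Lemma ascent_simple_nonneg s a : reduced s -> ascent s a ->
  nonneg_vector (word_act s (alpha a)).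
Proof.
have [m] := ubnP (size s); elim: m s a => // m IH [|t s] a sm rs has.
  by move=> i; rewrite /= mxE ler0n.
rewrite /= ltnS in sm.
have ta : t != a.
  apply/eqP => ta; have := has s; rewrite ta /= ltnn => H.
  by apply: notF; apply: H => x /=; rewrite sigmaK.
have rs' : reduced s.
  by move=> v vs; apply: (rs (t :: v)) => x /=; rewrite vs.
rewrite /=; case: (boolP (e t a)) => [eta|neta]; last first.
  rewrite sigma_simple_far //; apply: IH => // v vs.
  rewrite -ltnS; apply: (has (t :: v)) => x /=.
  by rewrite vs /= (sigma_commute x ta neta).
(* Here [sigma t] sends [alpha a] to [alpha a + alpha t]. If [a] ascends for [s], induction applies
   to both terms: [t] ascends because [t :: s] is reduced. *)
have [as'|nas] := pselect (ascent s a).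
  rewrite sigma_simple_adj // word_actD => i; rewrite mxE addr_ge0 //.
    exact: IH.
  apply: IH => // v vs; apply: ltnW; exact: (rs v vs).
(* Otherwise [s] can be made to start with [a]; [sigma t] followed by [sigma a] turns [alpha a] into
   [alpha t], and only the tail [v] is left to act. *)
have [v [sv rv szv]] := descent_word rs' nas.
have aet : e a t by rewrite e_sym.
rewrite sv /= sigma_simple_adj // sigmaD sigma_simple (sigma_simple_adj aet).
rewrite addrCA addNr addr0; apply: IH => // [|u us].
  by rewrite -ltnS -szv ltnW.
(* By the braid relation [t :: a :: u] acts as [a :: t :: s], so the ascent of [a] bounds its length
   from below. *)
rewrite -2!ltnS -szv; apply: (has (t :: a :: u)) => x /=.
by rewrite us /= sigma_braid // -sv.
Qed.

(** If [a] is no ascent, the reduced word can be made to start with [a]; this letter negates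
    [alpha a], and [a] ascends for the tail. *)
Lemma root_sign x : is_root e x -> nonneg_vector x \/ nonneg_vector (- x).
Proof.
move=> [w [a [/weyl_word[s0 hs0] ->]]]; rewrite hs0.
have [s hs rs] := reduced_word s0; rewrite -hs.
have [as'|nas] := pselect (ascent s a).
  by left; apply: ascent_simple_nonneg.
have [v [sv rv szv]] := descent_word rs nas.
right; rewrite -word_actN -sigma_simple sv /= sigmaK.
apply: ascent_simple_nonneg => // u us.
by apply: ltnW; rewrite -szv; apply: rs => z; rewrite us sv.
Qed.

Lemma root_form x : is_root e x -> cartan_form x x = 2.
Proof.
move=> [w [a [/weyl_word[s hs] ->]]]; rewrite hs word_act_form.
by rewrite cartan_form_simple cartan_pairing_simple eqxx e_irr subr0.
Qed.

Lemma sigma_root i x : is_root e x -> is_root e (sigma i x).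
Proof.
move=> [w [a [ww ->]]]; exists (sigma i \o w), a; split => //.
exact: weyl_comp (weyl_sigma _ _ _) ww.
Qed.

Lemma word_act_root s x : is_root e x -> is_root e (word_act s x).
Proof. by elim: s x => //= i s IH x rx; apply: IH; exact: sigma_root. Qed.

(** [sigma i] changes only the coordinate at [i], so by the constant sign of roots all other
    coordinates of [x] vanish; the value 2 of the form at roots makes the remaining one equal to
    1. *)
Lemma sigma_neg_simple i x : is_root e x -> nonneg_vector x ->
  sigma i x 0 i < 0 -> x = alpha i.
Proof.
move=> rx x0 neg.
have [/(_ i)|sN] := root_sign (sigma_root i rx); first by rewrite leNgt neg.
have xi : x = x 0 i *: alpha i.
  apply/rowP => j; rewrite !mxE eqxx /=; case: (eqVneq j i) => [->|ji].
    by rewrite mulr1.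
  rewrite mulr0; apply/le_anti; rewrite x0 andbT.
  by have := sN j; rewrite !mxE (negbTE ji) oppr_ge0.
have := root_form rx; have := x0 i; move: (x 0 i) xi => c -> c0.
rewrite cartan_formZl cartan_form_simple cartan_pairingZ.
rewrite cartan_pairing_simple eqxx e_irr subr0 mulrA -expr2 => q.
have q1 : c ^+ 2 = 1.
  by apply: (@mulIf _ 2%:R); rewrite ?pnatr_eq0 // mul1r; exact: q.
have /eqP -> : c == 1 by rewrite -(eqrXn2 (n := 2)) // q1 expr1n.
by rewrite scale1r.
Qed.

End Roots.

(** * Coxeter maps and standard vectors *)

Section Coxeter.
Variables (R : realType) (n p : nat) (e : rel 'I_n).
Hypotheses (e_sym : symmetric e) (e_irr : irreflexive e).
Hypothesis e_bip : forall a b : 'I_n, e a b -> (a < p)%N != (b < p)%N.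
Local Notation V := 'rV[R]_n.
Implicit Types (x z d f : V) (i j a : 'I_n) (b : bool).

(** The Boolean is the parity of the reflected vertices, [true] for odd, so that alternation becomes
    negation. *)
Definition coxeter_half b : V -> V :=
  if b then odd_coxeter p e else even_coxeter p e.

Lemma coxeter_half_word b :
  coxeter_half b = word_act e [seq i : 'I_n <- enum 'I_n | (i < p)%N == b].
Proof.
case: b; rewrite /coxeter_half /odd_coxeter /even_coxeter /word_act.
  by apply/funext => x; congr foldl; apply: eq_filter => i; rewrite eqb_id.
by apply/funext => x; congr foldl; apply: eq_filter => i; rewrite eqbF_neg -leqNgt.
Qed.

(** The letters are distinct and pairwise nonadjacent, so no reflection reads a coordinate altered
    by an earlier one. *)
Lemma word_act_stable (s : seq 'I_n) x j : uniq s ->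
  {in s &, forall i k, ~~ e i k} ->
  word_act e s x 0 j =
    if j \in s then - x 0 j + \sum_(k | e j k) x 0 k else x 0 j.
Proof.
elim: s x => [|i s IH] x //= /andP[nis us] st.
have st' : {in s &, forall i k, ~~ e i k}.
  by move=> k l ks ls; apply: st; rewrite inE ?ks ?ls orbT.
rewrite IH // inE; case: (eqVneq j i) => [->|ji] /=.
  by rewrite (negbTE nis) mxE eqxx.
rewrite mxE (negbTE ji); case: ifP => // js; congr (_ + _).
apply: eq_bigr => k jk; rewrite mxE; case: eqP => // ki.
by move: (st j i); rewrite !inE js eqxx orbT -ki jk => /(_ isT isT).
Qed.

Lemma coxeter_halfE b x j :
  coxeter_half b x 0 j =
    if (j < p)%N == b then - x 0 j + \sum_(k | e j k) x 0 k else x 0 j.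
Proof.
rewrite coxeter_half_word word_act_stable.
- by rewrite mem_filter mem_enum andbT.
- by rewrite filter_uniq // enum_uniq.
- move=> i k; rewrite !mem_filter => /andP[/eqP ib _] /andP[/eqP kb _].
  by apply/negP => /e_bip; rewrite ib kb eqxx.
Qed.

Lemma coxeter_half_nbr b x j : (j < p)%N == b ->
  \sum_(k | e j k) coxeter_half b x 0 k = \sum_(k | e j k) x 0 k.
Proof.
move=> jb; apply: eq_bigr => k /e_bip; rewrite coxeter_halfE (eqP jb).
by case: b {jb} => /=; case: (k < p)%N.
Qed.

Lemma coxeter_halfK b : involutive (coxeter_half b).
Proof.
move=> x; apply/rowP => j; rewrite coxeter_halfE; case: ifP => jb.
  by rewrite coxeter_half_nbr // coxeter_halfE jb opprD addrNK opprK.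
by rewrite coxeter_halfE jb.
Qed.

Lemma coxeter_halfN b x : coxeter_half b (- x) = - coxeter_half b x.
Proof. by rewrite coxeter_half_word word_actN. Qed.

Lemma alternatingN b m x :
  Defs.alternating (coxeter_half b) (coxeter_half (~~ b)) m (- x) =
  - Defs.alternating (coxeter_half b) (coxeter_half (~~ b)) m x.
Proof.
elim: m b x => //= m IH b x.
by have := IH (~~ b) (coxeter_half b x); rewrite negbK coxeter_halfN.
Qed.

(** The descent of a vector under alternating halves, the Boolean being the parity of the next half.
    It ends at a simple root which this half would negate. *)
Inductive reducible_to_simple : bool -> V -> Prop :=
| reducible_simple b a of (a < p)%N = b :
    reducible_to_simple b (simple_root R a)
| reducible_step b d of nonneg_vector d & nonneg_vector (coxeter_half b d) &
    reducible_to_simple (~~ b) (coxeter_half b d) : reducible_to_simple b d.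

Lemma alternating_reducible b m d : is_root e d -> nonneg_vector d ->
  ~ nonneg_vector (Defs.alternating (coxeter_half b) (coxeter_half (~~ b)) m d) ->
  reducible_to_simple b d.
Proof.
elim: m b d => //= m IH b d rd d0 alt.
have rc : is_root e (coxeter_half b d).
  by rewrite coxeter_half_word; exact: word_act_root.
have [c0|nc0] := pselect (nonneg_vector (coxeter_half b d)).
  by apply: reducible_step => //; apply: IH; rewrite ?negbK.
have [j cj] : exists j, coxeter_half b d 0 j < 0.
  apply: contrapT => nj; apply: nc0 => j; rewrite leNgt; apply/negP => cj.
  by apply: nj; exists j.
move: cj; rewrite coxeter_halfE; case: ifP => [jb cj|_]; last by rewrite ltNge d0.
(* At the coordinate [j] the whole half acts as [sigma j] alone. *)
rewrite (@sigma_neg_simple _ _ _ e_sym e_irr j d rd d0); last by rewrite mxE eqxx.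
by apply: reducible_simple; exact: (eqP jb).
Qed.

Lemma singular_reducible d : is_root e d -> singular p e d ->
  exists b, reducible_to_simple b d.
Proof.
move=> rd [d0 nreg].
have [t] : exists t, ~ nonneg_vector (coxeter p e t d).
  apply: contrapT => nt; apply: nreg; split => // t; apply: contrapT => ct.
  by apply: nt; exists t.
case: t => m ct; [exists true | exists false].
  exact: (@alternating_reducible true m).
exact: (@alternating_reducible false m.+1).
Qed.

Lemma reducible_neq0 b d : reducible_to_simple b d -> d != 0.
Proof.
elim=> {b d} [b a _|b d _ _ _ c0].
  by apply/eqP => /rowP/(_ a); rewrite !mxE !eqxx => /eqP; rewrite oner_eq0.
apply: contraNneq c0 => ->; apply/eqP/rowP => j; rewrite coxeter_halfE.
by rewrite big1 => [|k _]; rewrite !mxE // oppr0 addr0 if_same.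
Qed.

(** * Standard vectors through Chebyshev numbers *)

Section Standard.
Variables (lam : R) (y : V).
Hypotheses (lam2 : 2 <= lam) (y_gt0 : forall i, 0 < y 0 i).
Hypothesis y_eigen : forall i, \sum_(k | e i k) y 0 k = lam * y 0 i.
Hypothesis parity_onto : forall b, exists i : 'I_n, (i < p)%N = b.

(** Two consecutive values are carried along the recurrence; the first is the Chebyshev polynomial
    of the second kind of degree [k - 1] at [lam / 2], read as 0 for [k = 0]. *)
Fixpoint cheb_pair k : R * R :=
  if k is k'.+1 then let q := cheb_pair k' in (q.2, lam * q.2 - q.1) else (0, 1).

Definition cheb k : R := (cheb_pair k).1.

Lemma chebSS k : cheb k.+2 = lam * cheb k.+1 - cheb k.
Proof. by []. Qed.

(** As [lam >= 2], the differences of consecutive values do not decrease, and the first one is 1. *)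
Lemma cheb_ge0_lt k : 0 <= cheb k < cheb k.+1.
Proof.
elim: k => [|k /andP[c0 c1]]; first by rewrite lexx ltr01.
rewrite (le_trans c0 (ltW c1)) /= chebSS ltrBrDr.
have h : cheb k.+1 * 2 <= lam * cheb k.+1.
  by rewrite mulrC ler_wpM2r // (le_trans c0) // ltW.
by apply: lt_le_trans h; rewrite mulr_natr mulr2n ltrD2l.
Qed.

Lemma cheb_gt0 k : 0 < cheb k.+1.
Proof. by case/andP: (cheb_ge0_lt k); exact: le_lt_trans. Qed.

Lemma cheb_ge0 k : 0 <= cheb k.
Proof. by case/andP: (cheb_ge0_lt k). Qed.

(** Parity [b] has the smaller coefficient, which is 0 exactly at level [k = 0]; thus [std b 0] is
    the standard vector supported on parity [~~ b]. *)
Definition std b k : V :=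
  \row_j (if (j < p)%N == b then cheb k * y 0 j else cheb k.+1 * y 0 j).

Lemma std_ge0 b k : nonneg_vector (std b k).
Proof. by move=> j; rewrite mxE; case: ifP => _; rewrite mulr_ge0 ?cheb_ge0 ?ltW. Qed.

Lemma std_gt0 b k j : (j < p)%N != b -> 0 < std b k 0 j.
Proof. by move=> /negbTE jb; rewrite mxE jb mulr_gt0 ?cheb_gt0. Qed.

Lemma std_gt0S b k j : 0 < std b k.+1 0 j.
Proof. by rewrite mxE; case: ifP => _; rewrite mulr_gt0 ?cheb_gt0. Qed.

Lemma std0_eq0 b j : (j < p)%N == b -> std b 0 0 j = 0.
Proof. by move=> jb; rewrite mxE jb mul0r. Qed.

Lemma coxeter_half_std b k : coxeter_half b (std b k) = std (~~ b) k.+1.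
Proof.
apply/rowP => j; rewrite coxeter_halfE !mxE.
case: (boolP ((j < p)%N == b)) => [/eqP jb|jb].
  rewrite jb; have -> : (b == ~~ b) = false by case: b {jb}.
  rewrite chebSS mulrBl addrC; congr (_ - _).
  rewrite -mulrA mulrCA -y_eigen mulr_sumr; apply: eq_bigr => i /e_bip.
  by rewrite jb mxE eq_sym => /negbTE->.
by have -> : (j < p)%N == ~~ b by case: b jb; case: (j < p)%N.
Qed.

Lemma coxeter_half_stdS b k : coxeter_half (~~ b) (std b k.+1) = std (~~ b) k.
Proof.
by have := coxeter_half_std (~~ b) k; rewrite negbK => <-; rewrite coxeter_halfK.
Qed.

Lemma alternating_std b m k :
  Defs.alternating (coxeter_half b) (coxeter_half (~~ b)) m (std b k) =
  std (b (+) odd m) (k + m).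
Proof.
elim: m b k => [|m IH] b k /=; first by rewrite addbF addn0.
rewrite coxeter_half_std; have := IH (~~ b) k.+1; rewrite negbK => ->.
by rewrite addSnnS; congr std; case: b; case: odd.
Qed.

Lemma even_standardE : even_standard p y = std true 0.
Proof. by apply/rowP => j; rewrite !mxE eqb_id mul0r mul1r. Qed.

Lemma odd_standardE : odd_standard p y = std false 0.
Proof. by apply/rowP => j; rewrite !mxE eqbF_neg if_neg mul0r mul1r. Qed.

Lemma std_standard b k : standard_vector p e y (std b k).
Proof.
(* The starting parity is the one from which [k] alternations end at [b]; it selects the standard
   vector and the direction of time. *)
have := alternating_std (b (+) odd k) k 0; rewrite addbK add0n => <-.
case: (b (+) odd k).
  by exists (Posz k); left; rewrite even_standardE.
by case: k => [|k]; [exists 0 | exists (Negz k)]; right; rewrite odd_standardE.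
Qed.

(** In one direction of time the orbit climbs through the vectors [std]. In the other, the first
    half acts where the standard vector is supported and negates it; from then on the orbit consists
    of negatives of vectors [std], which are not nonnegative because both parities occur. *)
Lemma standard_nonneg_std f : standard_vector p e y f -> nonneg_vector f ->
  exists b k, f = std b k.
Proof.
have neg b k : ~ nonneg_vector (- std b k).
  have [j jb] := parity_onto (~~ b); move=> /(_ j).
  by rewrite mxE oppr_ge0 leNgt std_gt0 // jb; case: b {jb}.
have first_neg b : coxeter_half (~~ b) (std b 0) = - std b 0.
  apply/rowP => j; rewrite coxeter_halfE !mxE.
  case: (eqVneq (j < p)%N b) => [->|jb].
    have -> : (b == ~~ b) = false by case: b.
    by rewrite mul0r oppr0.
  have -> : (j < p)%N == ~~ b by case: b jb; case: (j < p)%N.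
  rewrite big1 ?addr0 // => i /e_bip ji; rewrite std0_eq0 //.
  by case: b jb ji; case: (j < p)%N; case: (i < p)%N.
have first_alt b m : Defs.alternating (coxeter_half (~~ b)) (coxeter_half b) m.+1 (std b 0)
    = - std (b (+) odd m) m.
  by rewrite /= first_neg alternatingN alternating_std.
move=> [[m|m] [->|->]]; rewrite ?even_standardE ?odd_standardE.
- by move=> _; do 2 eexists; exact: (alternating_std true).
- case: m => [_|m]; first by exists false, 0%N.
  by move=> h; have := @first_alt false m; rewrite /= => E; case: (@neg (false (+) odd m) m); rewrite -E.
- by move=> h; have := @first_alt true m; rewrite /= => E; case: (@neg (true (+) odd m) m); rewrite -E.
- by move=> _; do 2 eexists; exact: (alternating_std false m.+1).
Qed.

End Standard.
End Coxeter.

(** * Reflection of matrix representations *)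

Section Completion.
Variable C : numClosedFieldType.

Definition adjmx m n (A : 'M[C]_(m, n)) : 'M[C]_(n, m) := map_mx Num.conj A^T.

Lemma adjmxE m n (A : 'M[C]_(m, n)) i j : adjmx A i j = (A j i)^*.
Proof. by rewrite !mxE. Qed.

Lemma adjmxK m n (A : 'M[C]_(m, n)) : adjmx (adjmx A) = A.
Proof. by apply/matrixP => i j; rewrite !mxE conjCK. Qed.

Lemma adjmx_mul m n p (A : 'M[C]_(m, n)) (B : 'M[C]_(n, p)) :
  adjmx (A *m B) = adjmx B *m adjmx A.
Proof. by rewrite /adjmx trmx_mul map_mxM. Qed.

Lemma adjmxD m n (A B : 'M[C]_(m, n)) : adjmx (A + B) = adjmx A + adjmx B.
Proof. by rewrite /adjmx raddfD map_mxD. Qed.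

Lemma adjmxZ m n a (A : 'M[C]_(m, n)) : adjmx (a *: A) = a^* *: adjmx A.
Proof. by apply/matrixP => i j; rewrite !mxE rmorphM. Qed.

Lemma adjmx0 m n : adjmx (0 : 'M[C]_(m, n)) = 0.
Proof. by apply/matrixP => i j; rewrite !mxE rmorph0. Qed.

Lemma adjmx1 n : adjmx (1%:M : 'M[C]_n) = 1%:M.
Proof. by rewrite /adjmx trmx1 map_mx1. Qed.

Lemma mulmx_adj_ge0 m n (A : 'M[C]_(m, n)) i : 0 <= (A *m adjmx A) i i.
Proof.
by rewrite mxE sumr_ge0 // => j _; rewrite adjmxE mul_conjC_ge0.
Qed.

Lemma mulmx_adj_diag0 m n (A : 'M[C]_(m, n)) :
  (forall i, (A *m adjmx A) i i = 0) -> A = 0.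
Proof.
move=> A0; apply/matrixP => i j; have := A0 i; rewrite !mxE => /eqP.
rewrite psumr_eq0 => [|k _]; last by rewrite adjmxE mul_conjC_ge0.
by move/allP/(_ j (mem_index_enum _)); rewrite adjmxE mul_conjC_eq0 => /eqP.
Qed.

(** Divided by [sqrtC c], the rows of [X] are orthonormal. An orthonormal basis of their orthogonal
    complement completes them to a square unitary matrix, whose columns are then orthonormal too. *)
Lemma isometry_completion r r' N (X : 'M[C]_(r, N)) (c : C) :
  0 < c -> X *m adjmx X = c%:M -> (r + r' = N)%N ->
  exists Y : 'M[C]_(r', N), [/\ Y *m adjmx Y = c%:M, X *m adjmx Y = 0 &
    adjmx X *m X + adjmx Y *m Y = c%:M].
Proof.
move=> c0 XX rN; pose s := sqrtC c.
have s0 : s != 0 by rewrite sqrtC_eq0 gt_eqF.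
have sr : s^* = s by apply/CrealP; rewrite ger0_real // sqrtC_ge0 ltW.
have sVr : s^-1^* = s^-1 by apply/CrealP; rewrite ger0_real // invr_ge0 sqrtC_ge0 ltW.
have ss : s * s = c by rewrite -expr2 sqrtCK.
pose X0 := s^-1 *: X.
have X0u : X0 \is unitarymx.
  apply/unitarymxP; rewrite -/(adjmx X0) adjmxZ -scalemxAl -scalemxAr XX scalerA.
  by rewrite scale_scalar_mx sVr -invfM ss mulVf ?gt_eqF.
pose K := kermx (adjmx X0).
have rK : \rank K = r'.
  rewrite mxrank_ker (_ : \rank _ = r); first by rewrite -rN addKn.
  by rewrite /adjmx mxrank_map mxrank_tr mxrank_unitary.
have [Y0 Y0u Y0X] : exists2 Y0 : 'M[C]_(r', N), Y0 \is unitarymx & Y0 *m adjmx X0 = 0.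
  (* The basis [row_base K] has [\rank K] rows, so [r'] is replaced by this rank in the type. *)
  case: _ / rK; exists (schmidt (row_base K)).
    by rewrite schmidt_unitarymx // rank_leq_col.
  by apply/sub_kermxP; rewrite eqmx_schmidt_free ?row_base_free // eq_row_base.
have X0Y : X0 *m adjmx Y0 = 0.
  by rewrite -[LHS]adjmxK adjmx_mul adjmxK Y0X adjmx0.
have XYu : col_mx X0 Y0 \is unitarymx.
  apply/unitarymxP; rewrite tr_col_mx map_row_mx mul_col_row.
  rewrite -/(adjmx X0) -/(adjmx Y0) X0Y Y0X.
  by rewrite (unitarymxP X0u) (unitarymxP Y0u) -scalar_mx_block.
have := mulmxKtV 1%:M XYu rN; rewrite mul1mx tr_col_mx map_row_mx mul_row_col.
rewrite -/(adjmx X0) -/(adjmx Y0) => full.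
have XE : X = s *: X0 by rewrite scalerA divff ?scale1r.
clearbody X0.
exists (s *: Y0); rewrite adjmxZ sr; split.
- by rewrite -scalemxAl -scalemxAr scalerA ss (unitarymxP Y0u) scale_scalar_mx mulr1.
- by rewrite XE -scalemxAl -scalemxAr X0Y !scaler0.
- rewrite XE adjmxZ sr -!scalemxAl -!scalemxAr !scalerA ss -scalerDr full.
  by rewrite scale_scalar_mx mulr1.
Qed.

(** The completion is applied to the block row of all [X j], and its identities are read off block
    by block. *)
Lemma block_isometry_completion n (q : 'I_n -> nat) r r'
    (X : forall j, 'M[C]_(r, q j)) (c : C) :
  0 < c -> \sum_j X j *m adjmx (X j) = c%:M -> (r + r' = \sum_j q j)%N ->
  exists Y : forall j, 'M[C]_(r', q j),
    [/\ \sum_j Y j *m adjmx (Y j) = c%:M,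
        \sum_j X j *m adjmx (Y j) = 0,
        forall j, adjmx (X j) *m X j + adjmx (Y j) *m Y j = c%:M &
        forall i j, i != j -> adjmx (X i) *m X j + adjmx (Y i) *m Y j = 0].
Proof.
move=> c0 XX rN.
have adj_row m (Z : forall j, 'M[C]_(m, q j)) :
    adjmx (\mxrow_j Z j) = \mxcol_j adjmx (Z j).
  by apply/matrixP => i j; rewrite !mxE.
have [|Y0 [YY XY full]] := isometry_completion (X := \mxrow_j X j) c0 _ rN.
  by rewrite adj_row mul_mxrow_mxcol.
pose Y j := submxrow Y0 j.
have YE : Y0 = \mxrow_j Y j by rewrite submxrowK.
clearbody Y; move: YY XY full.
rewrite YE !adj_row !mul_mxrow_mxcol !mul_mxcol_mxrow -mxblockD => YY XY full.
exists Y; split => //.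
- move=> j; have := congr1 (fun A => submxblock A j j) full.
  rewrite mxblockK => ->; apply/matrixP => a b; rewrite !mxE.
  by rewrite -val_eqE /= tagnat.eq_Rank eqxx.
- move=> i j ij; have := congr1 (fun A => submxblock A i j) full.
  rewrite mxblockK => ->; apply/matrixP => a b; rewrite !mxE.
  by rewrite -val_eqE /= tagnat.eq_Rank (negbTE ij).
Qed.
End Completion.

(** * Locally scalar representations in coordinates and their reflections *)

Section MatrixRepresentations.
Variable C : numClosedFieldType.

(* Functions on [nat * nat] stand for matrices whose sizes are only known
   propositionally; entries outside of the sizes are irrelevant. *)
Definition nmx r s (h : nat -> nat -> C) : 'M[C]_(r, s) := \matrix_(i, j) h i j.

Lemma nmx_onto r s (M : 'M[C]_(r, s)) : exists h, nmx r s h = M.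
Proof.
exists (fun i j => if (insub i, insub j) is (Some i', Some j') then M i' j' else 0).
by apply/matrixP => i j; rewrite mxE !valK.
Qed.

Lemma nmx_adj r s (h : nat -> nat -> C) :
  nmx s r (fun i j => (h j i)^*) = adjmx (nmx r s h).
Proof. by apply/matrixP => i j; rewrite !mxE. Qed.

Lemma unitary_adjmxr r (U : 'M[C]_r) : U \is unitarymx -> U *m adjmx U = 1%:M.
Proof. by move/unitarymxP. Qed.

Lemma unitary_adjmxl r (U : 'M[C]_r) : U \is unitarymx -> adjmx U *m U = 1%:M.
Proof. by move/unitary_adjmxr/mulmx1C. Qed.

Variables (n : nat) (e : rel 'I_n).
Hypothesis e_sym : symmetric e.
Local Notation maps := ('I_n -> 'I_n -> nat -> nat -> C).
Implicit Types (k : 'I_n -> nat) (f : 'I_n -> C) (m : maps).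

Definition matrix_rep k f m : Prop :=
  (forall a b, e a b -> nmx (k b) (k a) (m b a) = adjmx (nmx (k a) (k b) (m a b))) /\
  (forall g, \sum_(b | e g b)
     nmx (k g) (k b) (m g b) *m adjmx (nmx (k g) (k b) (m g b)) = (f g)%:M).

Definition matrix_equiv k m m' : Prop :=
  exists u : 'I_n -> nat -> nat -> C,
    (forall a, nmx (k a) (k a) (u a) \is unitarymx) /\
    (forall a b, e a b -> nmx (k a) (k a) (u a) *m nmx (k a) (k b) (m a b) =
                          nmx (k a) (k b) (m' a b) *m nmx (k b) (k b) (u b)).

Lemma eq_matrix_rep k f f' m : f =1 f' -> matrix_rep k f m -> matrix_rep k f' m.
Proof. by move=> ff' [adj chr]; split=> // g; rewrite chr ff'. Qed.

Variable eps : pred 'I_n.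
Hypothesis e_eps : forall a b, e a b -> eps a != eps b.

Lemma eps_nbr g b : eps g -> e g b -> ~~ eps b.
Proof. by move=> eg /e_eps; rewrite eg; case: (eps b). Qed.

(* At each vertex g of [eps], the rows of the block matrices (m g b)_b and
   (m' g b)_b span orthogonal complements in the sum of the spaces at the
   neighbours b of g. *)
Definition complementary k k' f m m' : Prop := forall g, eps g ->
  [/\ \sum_(b | e g b) nmx (k g) (k b) (m g b) *m adjmx (nmx (k' g) (k b) (m' g b)) = 0,
      forall b, e g b ->
        adjmx (nmx (k g) (k b) (m g b)) *m nmx (k g) (k b) (m g b) +
        adjmx (nmx (k' g) (k b) (m' g b)) *m nmx (k' g) (k b) (m' g b) = (f g)%:M &
      forall b c, e g b -> e g c -> b != c ->
        adjmx (nmx (k g) (k b) (m g b)) *m nmx (k g) (k c) (m g c) +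
        adjmx (nmx (k' g) (k b) (m' g b)) *m nmx (k' g) (k c) (m' g c) = 0].

(** At [eps] the complement keeps the scale of the old row; off [eps], each neighbour [g]
    contributes [f g] minus its old term to the new operator. *)
Definition reflect_character f a : C :=
  if eps a then f a else \sum_(g | e a g) f g - f a.

(** The reflection functor on objects: the block row at each vertex of [eps] is completed by the
    blocks of the new space. Positivity of [f] there permits the rescaling to orthonormal rows. *)
Lemma matrix_rep_reflect k k' f m : matrix_rep k f m ->
  (forall b, ~~ eps b -> k' b = k b) ->
  (forall g, eps g -> (k g + k' g = \sum_(b | e g b) k b)%N) ->
  (forall g, eps g -> 0 < f g) ->
  exists m', complementary k k' f m m' /\
    matrix_rep k' (reflect_character f) m'.
Proof.
move=> [adj chr] kE kS f0.
have /boolp.choice[H HP] g : exists h : 'I_n -> nat -> nat -> C, eps g ->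
   [/\ \sum_(b | e g b) nmx (k' g) (k b) (h b) *m adjmx (nmx (k' g) (k b) (h b)) = (f g)%:M,
       \sum_(b | e g b) nmx (k g) (k b) (m g b) *m adjmx (nmx (k' g) (k b) (h b)) = 0,
      forall b, e g b ->
        adjmx (nmx (k g) (k b) (m g b)) *m nmx (k g) (k b) (m g b) +
        adjmx (nmx (k' g) (k b) (h b)) *m nmx (k' g) (k b) (h b) = (f g)%:M &
      forall b c, e g b -> e g c -> b != c ->
        adjmx (nmx (k g) (k b) (m g b)) *m nmx (k g) (k c) (m g c) +
        adjmx (nmx (k' g) (k b) (h b)) *m nmx (k' g) (k c) (h c) = 0].
  case: (boolP (eps g)) => eg; last by exists (m g).
  (* Non-neighbours get size 0, so that the block row runs over all vertices without changing any
     sum. *)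
  pose q j := if e g j then k j else 0%N.
  have sum_q r s (h1 h2 : 'I_n -> nat -> nat -> C) :
      \sum_(b | e g b) nmx r (k b) (h1 b) *m adjmx (nmx s (k b) (h2 b)) =
      \sum_b nmx r (q b) (h1 b) *m adjmx (nmx s (q b) (h2 b)).
    rewrite big_mkcond; apply: eq_bigr => b _; rewrite /q; case: ifP => // _.
    by apply/matrixP => i j; rewrite !mxE big_ord0.
  have [||Y [YY XY Yd Yo]] := @block_isometry_completion C n q (k g) (k' g)
    (fun j => nmx (k g) (q j) (m g j)) (f g) (f0 g eg).
  - by rewrite -sum_q.
  - by rewrite kS // big_mkcond.
  have /boolp.choice[h hY] := fun j => nmx_onto (Y j).
  exists h => _; rewrite !sum_q; split.
  - by rewrite -[RHS]YY; apply: eq_bigr => j _; rewrite hY.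
  - by rewrite -[RHS]XY; apply: eq_bigr => j _; rewrite hY.
  - by move=> b gb; have := Yd b; rewrite -hY /q gb.
  - by move=> b c gb gc bc; have := Yo b c bc; rewrite -!hY /q gb gc.
(* Only the blocks entering vertices of [eps] come from the completion; the opposite ones are their
   adjoints. *)
pose m' a b := if eps a then H a b else fun i j => (H b a j i)^*.
exists m'; split=> [g eg|].
  by have [_ ? ? ?] := HP g eg; rewrite /m' eg.
split=> [a b ab|g].
  have := e_eps ab; rewrite /m'; case: (eps a); case: (eps b) => // _.
    by rewrite nmx_adj.
  by rewrite nmx_adj adjmxK.
rewrite /reflect_character; case: (boolP (eps g)) => eg.
  have [YY _ _ _] := HP g eg; rewrite -YY; apply: eq_bigr => b gb.
  by rewrite /m' eg (kE _ (eps_nbr eg gb)).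
have fgE : (\sum_(b | e g b) f b - f g)%:M = \sum_(b | e g b) (f b)%:M -
    \sum_(b | e g b) nmx (k g) (k b) (m g b) *m adjmx (nmx (k g) (k b) (m g b)).
  by rewrite chr !raddfB raddf_sum.
rewrite kE // fgE -sumrB; apply: eq_bigr => b gb.
have eb : eps b by have := e_eps gb; rewrite (negbTE eg); case: (eps b).
have bg : e b g by rewrite e_sym.
have [_ _ /(_ g bg) <- _] := HP b eb.
rewrite /m' (negbTE eg) nmx_adj adjmxK (adj _ _ bg) adjmxK.
by rewrite addrC addKr.
Qed.

(** Taking adjoints of the relation on an edge and cancelling the unitaries gives the relation in
    the opposite direction. *)
Lemma matrix_equiv_half k m m' f f' (u : 'I_n -> nat -> nat -> C) :
  matrix_rep k f m -> matrix_rep k f' m' ->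
  (forall a, nmx (k a) (k a) (u a) \is unitarymx) ->
  (forall a b, eps a -> e a b -> nmx (k a) (k a) (u a) *m nmx (k a) (k b) (m a b) =
                          nmx (k a) (k b) (m' a b) *m nmx (k b) (k b) (u b)) ->
  matrix_equiv k m m'.
Proof.
move=> [adj _] [adj' _] uu ui; exists u; split=> // a b ab.
case: (boolP (eps a)) => ea; first exact: ui.
have eb : eps b by have := e_eps ab; rewrite (negbTE ea); case: (eps b).
have ba : e b a by rewrite e_sym.
rewrite (adj _ _ ba) (adj' _ _ ba).
have := congr1 (fun M => nmx (k a) (k a) (u a) *m adjmx M *m nmx (k b) (k b) (u b)) (ui _ _ eb ba).
rewrite !adjmx_mul !mulmxA (unitary_adjmxr (uu a)) mul1mx.
by rewrite -!mulmxA (unitary_adjmxl (uu b)) mulmx1 => ->.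
Qed.

(* With X, X' the block rows of m, m' at a vertex g of [eps] and W the block
   diagonal matrix of the unitaries at its neighbours, the unitary at g is
   (f g)^-1 X' W X^*. *)
Lemma matrix_equiv_reflect k k' f f2 m m' m2 m2' :
  (forall b, ~~ eps b -> k' b = k b) -> (forall g, eps g -> 0 < f g) ->
  matrix_rep k f m -> matrix_rep k f m' ->
  matrix_rep k' f2 m2 -> matrix_rep k' f2 m2' ->
  complementary k k' f m m2 -> complementary k k' f m' m2' ->
  matrix_equiv k' m2 m2' -> matrix_equiv k m m'.
Proof.
move=> kE f0 rm rm' rm2 rm2' cm cm' [w [wu wi]].
have [adj chr] := rm; have [adj' chr'] := rm'.
pose W b := nmx (k b) (k b) (w b).
pose X g b := nmx (k g) (k b) (m g b).
pose X' g b := nmx (k g) (k b) (m' g b).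
have /boolp.choice[v vP] g : exists v : nat -> nat -> C, nmx (k g) (k g) v =
    if eps g then (f g)^-1 *: \sum_(b | e g b) X' g b *m W b *m adjmx (X g b)
    else W g.
  exact: nmx_onto.
have Wu b : ~~ eps b -> W b \is unitarymx.
  by move=> eb; have := wu b; rewrite kE.
have vX g b : eps g -> e g b ->
    nmx (k g) (k g) (v g) *m X g b = X' g b *m nmx (k b) (k b) (v b).
  move=> eg gb; have nb := eps_nbr eg gb.
  have [_ Xd Xo] := cm g eg; have [XY' _ _] := cm' g eg.
  pose Y c := nmx (k' g) (k c) (m2 g c).
  pose Y' c := nmx (k' g) (k c) (m2' g c).
  rewrite !vP eg (negbTE nb).
  have WY c : e g c -> W c *m adjmx (Y c) = adjmx (Y' c) *m nmx (k' g) (k' g) (w g).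
    move=> gc; have nc := eps_nbr eg gc; have := wi _ _ gc.
    rewrite (kE c nc) -/(Y c) -/(Y' c) -/(W c) => wY.
    have := congr1 (fun M => W c *m adjmx M *m nmx (k' g) (k' g) (w g)) wY.
    rewrite !adjmx_mul !mulmxA (unitary_adjmxr (Wu c nc)) mul1mx.
    by rewrite -mulmxA (unitary_adjmxl (wu g)) mulmx1.
  (* [W] carries the complement of the rows [X] to that of the rows [X'], so the mixed product
     vanishes. *)
  have cross : \sum_(c | e g c) X' g c *m W c *m adjmx (Y c) = 0.
    transitivity ((\sum_(c | e g c) X' g c *m adjmx (Y' c)) *m nmx (k' g) (k' g) (w g)).
      rewrite mulmx_suml; apply: eq_bigr => c gc.
      by rewrite -mulmxA WY // mulmxA.
    by rewrite XY' mul0mx.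
  suff key : (\sum_(c | e g c) X' g c *m W c *m adjmx (X g c)) *m X g b =
      f g *: (X' g b *m W b).
    by rewrite -scalemxAl key scalerA mulVf ?scale1r // gt_eqF ?f0.
  (* Adding [cross] times [Y b], which is zero, brings in the complementarity identities; only the
     term at [b] survives. *)
  rewrite -[LHS]addr0 -(mul0mx _ (Y b)) -cross !mulmx_suml -big_split /=.
  rewrite (bigD1 b) //= big1 ?addr0 => [|c /andP[gc cb]].
    by rewrite -!mulmxA -!mulmxDr Xd // !mulmxA mul_mx_scalar.
  by rewrite -!mulmxA -!mulmxDr Xo // !mulmx0.
apply: (matrix_equiv_half rm rm' _ vX) => g.
case: (boolP (eps g)) => eg; last by rewrite vP (negbTE eg) Wu.
apply/unitarymxP; rewrite -/(adjmx _); set V := nmx _ _ _.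
apply: (scalerI (lt0r_neq0 (f0 g eg))); rewrite scale_scalar_mx mulr1.
(* The scalar [f g] is expanded by [chr] between [V] and its adjoint and by [chr'] on the right;
   [vX] then matches the sums term by term. *)
rewrite scalemxAr -mul_scalar_mx -[RHS]chr' -chr mulmx_suml mulmx_sumr.
apply: eq_bigr => b gb.
have := congr1 (fun M => M *m adjmx M) (vX g b eg gb).
rewrite -/V !adjmx_mul !mulmxA => ->.
rewrite vP (negbTE (eps_nbr eg gb)) -!mulmxA [W b *m (_ *m _)]mulmxA.
by rewrite (unitary_adjmxr (Wu b _)) ?mul1mx // (eps_nbr eg gb).
Qed.
End MatrixRepresentations.

(** * Vanishing characters and vanishing dimensions *)

Section DegenerateMatrixRepresentations.
Variables (C : numClosedFieldType) (n : nat) (e : rel 'I_n).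
Hypothesis e_sym : symmetric e.
Implicit Types (k : 'I_n -> nat) (f : 'I_n -> C) (m : 'I_n -> 'I_n -> nat -> nat -> C).

Lemma flatmxP r s (A B : 'M[C]_(r, s)) : r = 0%N \/ s = 0%N -> A = B.
Proof.
by case=> h; [move: A B; rewrite h => A B | move: A B; rewrite h => A B];
  apply/matrixP => i j; [case: i | case: j].
Qed.

Lemma matrix_rep_char0 k f m a : matrix_rep e k f m -> k a != 0%N ->
  (forall b, e a b -> k b = 0%N) -> f a = 0.
Proof.
rewrite -lt0n => -[_ /(_ a)/matrixP/(_ (Ordinal _) (Ordinal _)) chr] ka kb.
have := chr _ ka _ ka; rewrite [RHS]mxE eqxx mulr1n => <-.
rewrite big1 ?mxE // => b ab; apply/matrixP => i j; rewrite !mxE big1 // => l _.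
by case: l => l; rewrite (kb b ab).
Qed.

(** Where [f g = 0], a sum of positive semidefinite terms vanishes, so every block at [g] is zero.
    The operator at [b] is then zero, and it equals a nonzero scalar only in dimension 0. *)
Lemma matrix_rep_dim0 k f m b : matrix_rep e k f m ->
  (forall g, e b g -> f g = 0) -> f b != 0 -> k b = 0%N.
Proof.
move=> [adj chr] f0 fb; have m0 g : e b g -> nmx (k b) (k g) (m b g) = 0.
  move=> bg; have gb : e g b by rewrite e_sym.
  rewrite (adj _ _ gb) (_ : nmx _ _ _ = 0) ?adjmx0 //.
  apply: mulmx_adj_diag0 => i; have := chr g; rewrite (f0 g bg) raddf0.
  move/matrixP/(_ i i)/eqP; rewrite summxE mxE psumr_eq0 => [/allP h|c _].
    by have /implyP/(_ gb)/eqP := h b (mem_index_enum _).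
  exact: mulmx_adj_ge0.
have := chr b; rewrite big1 => [/matrixP f00|g bg]; last by rewrite m0 // mul0mx.
apply/eqP; rewrite -leqn0 leqNgt; apply: contra fb => kb.
by have := f00 (Ordinal kb) (Ordinal kb); rewrite !mxE eqxx mulr1n => <-.
Qed.

Lemma matrix_equiv_orthogonal k m m' :
  (forall a b, e a b -> k a = 0%N \/ k b = 0%N) -> matrix_equiv e k m m'.
Proof.
move=> k0; exists (fun _ i j => (i == j)%:R); split=> [a|a b ab]; last first.
  exact/flatmxP/k0.
have -> : nmx (k a) (k a) (fun i j => (i == j)%:R) = 1%:M :> 'M[C]_(k a).
  by apply/matrixP => i j; rewrite !mxE.
by apply/unitarymxP; rewrite -/(adjmx _) adjmx1 mulmx1.
Qed.

End DegenerateMatrixRepresentations.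

(** * Coordinates in orthonormal bases *)

Section Coordinates.
Variable R : realType.
Local Notation C := (R[i]).
Implicit Types H K : hilbertSpace R.

Definition orthonormal_basis H k (b : 'I_k -> H) : Prop :=
  (forall i j, hdot H (b i) (b j) = (i == j)%:R) /\
  (forall x : H, x = \sum_i hdot H x (b i) *: b i).

Definition coords H k (b : 'I_k -> H) (x : H) : 'cV[C]_k := \col_i hdot H x (b i).

Definition from_coords H k (b : 'I_k -> H) (v : 'cV[C]_k) : H := \sum_i v i 0 *: b i.

Definition opmx H K k l (b : 'I_k -> H) (c : 'I_l -> K) (g : H -> K) : 'M[C]_(l, k) :=
  \matrix_(i, j) hdot K (g (b j)) (c i).

Lemma hdot_conj H (x z : H) : hdot H x z = (hdot H z x)^*.
Proof. by rewrite [LHS]hermC expr0 mul1r. Qed.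

Lemma coordsD H k (b : 'I_k -> H) x z : coords b (x + z) = coords b x + coords b z.
Proof. by apply/colP => i; rewrite !mxE linearDl. Qed.

Lemma coordsZ H k (b : 'I_k -> H) a x : coords b (a *: x) = a *: coords b x.
Proof. by apply/colP => i; rewrite !mxE linearZl_LR. Qed.

Lemma coords0 H k (b : 'I_k -> H) : coords b 0 = 0.
Proof. by apply/colP => i; rewrite !mxE linear0l. Qed.

Lemma coords_sum H k (b : 'I_k -> H) I (r : seq I) (P : pred I) (F : I -> H) :
  coords b (\sum_(i <- r | P i) F i) = \sum_(i <- r | P i) coords b (F i).
Proof. exact: (big_morph _ (coordsD b) (coords0 b)). Qed.

Lemma from_coords_linear H k (b : 'I_k -> H) : linear (from_coords b).
Proof.
move=> a v w; rewrite /from_coords scaler_sumr -big_split; apply: eq_bigr => i _.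
by rewrite !mxE scalerDl scalerA.
Qed.

Lemma coordsK H k (b : 'I_k -> H) : orthonormal_basis b ->
  cancel (coords b) (from_coords b).
Proof.
move=> [_ bE] x; rewrite [RHS]bE; apply: eq_bigr => i _; by rewrite mxE.
Qed.

Lemma from_coordsK H k (b : 'I_k -> H) : orthonormal_basis b ->
  cancel (from_coords b) (coords b).
Proof.
move=> [bb _] v; rewrite coords_sum; apply/colP => i.
rewrite summxE (bigD1 i) //= coordsZ !mxE bb eqxx mulr1 big1 ?addr0 // => j ji.
by rewrite coordsZ !mxE bb (negbTE ji) mulr0.
Qed.

Lemma hdot_coords H k (b : 'I_k -> H) x z : orthonormal_basis b ->
  hdot H x z = (adjmx (coords b z) *m coords b x) 0 0.
Proof.
move=> bb; rewrite -{1}[x](coordsK bb) /from_coords linear_sumlz mxE.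
apply: eq_bigr => i _; rewrite linearZl_LR adjmxE !mxE mulrC; congr (_ * _).
exact: hdot_conj.
Qed.

Lemma coords_opmx H K k l (b : 'I_k -> H) (c : 'I_l -> K) (g : {linear H -> K}) x :
  orthonormal_basis b -> coords c (g x) = opmx b c g *m coords b x.
Proof.
move=> bb; rewrite -{1}[x](coordsK bb) /from_coords linear_sum coords_sum.
apply/colP => i; rewrite summxE !mxE; apply: eq_bigr => j _.
by rewrite linearZ coordsZ !mxE mulrC.
Qed.

Lemma opmx_adjoint H K k l (b : 'I_k -> H) (c : 'I_l -> K) (g : H -> K) (h : K -> H) :
  adjoint_pair g h -> opmx c b h = adjmx (opmx b c g).
Proof.
move=> gh; apply/matrixP => i j; rewrite adjmxE !mxE gh.
exact: hdot_conj.
Qed.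

Section MatrixOperator.
Variables (H K : hilbertSpace R) (k l : nat) (b : 'I_k -> H) (c : 'I_l -> K).
Variable A : 'M[C]_(l, k).

Definition matrix_operator (x : H) : K := from_coords c (A *m coords b x).

Lemma matrix_operator_linear : linear matrix_operator.
Proof.
move=> a x z; rewrite /matrix_operator coordsD coordsZ mulmxDr -scalemxAr.
exact: from_coords_linear.
Qed.

HB.instance Definition _ :=
  GRing.isLinear.Build C H K _ matrix_operator matrix_operator_linear.

Lemma coords_matrix_operator x : orthonormal_basis c ->
  coords c (matrix_operator x) = A *m coords b x.
Proof. by move=> cc; rewrite from_coordsK. Qed.
End MatrixOperator.

Lemma matrix_operator_unitary H K k (b : 'I_k -> H) (c : 'I_k -> K) (A : 'M[C]_k) :
  orthonormal_basis b -> orthonormal_basis c -> A \is unitarymx ->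
  unitary_operator (matrix_operator b c A).
Proof.
move=> bb cc Au; have Al := unitary_adjmxl Au; have Ar := unitary_adjmxr Au.
split=> [x z|].
  rewrite -[LHS]/(hdot K _ _) -[RHS]/(hdot H _ _) (hdot_coords _ _ cc) (hdot_coords _ _ bb) !coords_matrix_operator //.
  by rewrite adjmx_mul mulmxA -[_ *m adjmx A *m A]mulmxA Al mulmx1.
exists (matrix_operator c b (adjmx A)) => x.
  rewrite {1}/matrix_operator coords_matrix_operator // mulmxA Al mul1mx.
  exact: coordsK.
rewrite {1}/matrix_operator coords_matrix_operator // mulmxA Ar mul1mx.
exact: coordsK.
Qed.

End Coordinates.

(** * Matrices as operators between the spaces [C^k] *)

Section EuclidMap.
Variables (R : realType) (k l : nat).
Local Notation C := (R[i]).

Definition euclid_map (A : 'M[C]_(l, k)) (x : euclid R k) : euclid R l := x *m A^T.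

Lemma euclid_map_linear A : linear (euclid_map A).
Proof. by move=> a x z; rewrite /euclid_map mulmxDl -scalemxAl. Qed.

HB.instance Definition _ A := GRing.isLinear.Build C (euclid R k) (euclid R l) _
  (euclid_map A) (euclid_map_linear A).

Lemma euclid_map_adjoint A (x : euclid R k) (z : euclid R l) :
  euclid_dot (euclid_map A x) z = euclid_dot x (z *m (adjmx A)^T).
Proof.
rewrite !euclid_dotE.
under eq_bigr do rewrite mxE mulr_suml.
under [RHS]eq_bigr do rewrite mxE rmorph_sum mulr_sumr.
rewrite exchange_big; apply: eq_bigr => i _; apply: eq_bigr => j _.
by rewrite !mxE rmorphM /= conjCK; ring.
Qed.
End EuclidMap.

(** * Standard representations *)

Section StandardRepresentations.
Variables (R : realType) (n p : nat) (e : rel 'I_n).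
Hypotheses (e_sym : symmetric e) (e_irr : irreflexive e).
Hypothesis e_bip : forall a b : 'I_n, e a b -> (a < p)%N != (b < p)%N.
Variables (lam : R) (y : 'rV[R]_n).
Hypotheses (lam2 : 2 <= lam) (y_gt0 : forall i, 0 < y 0 i).
Hypothesis y_eigen : forall i, \sum_(k | e i k) y 0 k = lam * y 0 i.
Local Notation C := (R[i]).
Local Notation cox := (@coxeter_half R n p e).
Local Notation std := (@std R n p lam y).

Definition complex_vector (f : 'rV[R]_n) (g : 'I_n) : C := (f 0 g)%:C%C.

Definition side b : pred 'I_n := fun g => (g < p)%N == b.

Lemma side_bip b a c : e a c -> side b a != side b c.
Proof. by rewrite /side => /e_bip; case: b; case: (a < p)%N; case: (c < p)%N. Qed.

Lemma side_negb b g : side (~~ b) g = ~~ side b g.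
Proof. by rewrite /side; case: b; case: (g < p)%N. Qed.

Lemma reflect_character_complex b f :
  reflect_character e (side b) (complex_vector f) =1
  complex_vector (cox (~~ b) f).
Proof.
move=> a; rewrite /reflect_character /complex_vector (coxeter_halfE e_bip).
rewrite -/(side (~~ b) a) side_negb; case: (side b a) => //=.
by rewrite rmorphD rmorphN rmorph_sum /= addrC.
Qed.

(** The subtraction is truncated; it is exact once the reflected vector is known to be
    nonnegative. *)
Definition reflect_dim b (k : 'I_n -> nat) (g : 'I_n) : nat :=
  if side b g then (\sum_(c | e g c) k c - k g)%N else k g.

Lemma reflect_dimP b (d : 'rV[R]_n) k :
  (forall g, d 0 g = (k g)%:R) -> nonneg_vector (cox b d) ->
  (forall g, side b g -> (k g + reflect_dim b k g = \sum_(c | e g c) k c)%N) /\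
  (forall g, cox b d 0 g = (reflect_dim b k g)%:R).
Proof.
move=> dk c0.
have coxg g : side b g -> cox b d 0 g = (\sum_(c | e g c) k c)%N%:R - (k g)%:R.
  move=> gb; rewrite (coxeter_halfE e_bip) -/(side b g) gb addrC dk natr_sum.
  by congr (_ - _); apply: eq_bigr => c _.
have le g : side b g -> (k g <= \sum_(c | e g c) k c)%N.
  by move=> gb; have := c0 g; rewrite coxg // subr_ge0 ler_nat.
split=> [g gb|g]; rewrite /reflect_dim; first by rewrite gb subnKC // le.
case: ifP => gb; first by rewrite coxg // natrB // le.
by rewrite (coxeter_halfE e_bip) -/(side b g) gb.
Qed.

Lemma simple_rootE (a g : 'I_n) : simple_root R a 0 g = (g == a)%:R.
Proof. by rewrite mxE eqxx. Qed.

Lemma complex_vector_gt0 f g : (0 < complex_vector f g) = (0 < f 0 g).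
Proof. by rewrite /complex_vector ltcR. Qed.

Lemma reducible_matrix_rep_exists b (d : 'rV[R]_n) : reducible_to_simple p e b d ->
  exists k m i, (forall g, d 0 g = (k g)%:R) /\
    matrix_rep e k (complex_vector (std b i)) m.
Proof.
elim=> {b d} [b a ab|b d d0 c0 _ [k [m [i [dk rm]]]]].
  (* The simple root is realised by zero blocks; its character of level 0 vanishes on the parity of
     [a]. *)
  exists (fun g => (g == a : nat)), (fun _ _ _ _ => 0), 0%N; split=> [g|].
    exact: simple_rootE.
  have z r s : nmx r s (fun _ _ => 0) = 0 :> 'M[C]_(r, s).
    by apply/matrixP => i j; rewrite !mxE.
  split=> [a' b' _|g]; first by rewrite !z adjmx0.
  rewrite big1 => [|c _]; last by rewrite z mul0mx.
  case: (eqVneq g a) => [->|ga]; last by apply: flatmxP; left.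
  rewrite /complex_vector std0_eq0 ?raddf0 //; exact/eqP.
have cd0 : nonneg_vector (cox b (cox b d)) by rewrite coxeter_halfK.
have [kS kE] := reflect_dimP dk cd0; rewrite coxeter_halfK // in kE.
have [] := @matrix_rep_reflect C n e e_sym (side b) (@side_bip b) k
  (reflect_dim b k) _ m rm.
- by move=> g /negbTE gb; rewrite /reflect_dim gb.
- by [].
(* The reflected parity [b] is the one where [std (~~ b) i] is positive even at level 0. *)
- move=> g gb; rewrite complex_vector_gt0 std_gt0 //.
  by move: gb; rewrite /side => /eqP->; case: (b).
move=> m' [_ rm']; exists (reflect_dim b k), m', i.+1; split=> //.
apply: eq_matrix_rep rm' => g; rewrite reflect_character_complex.
by rewrite coxeter_half_std // negbK.
Qed.

(** [F] is fixed before the representation while parity and level of the character stay free, so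
    representations whose standard characters might differ are compared with the same [F]. *)
Lemma reducible_matrix_rep_unique b (d : 'rV[R]_n) : reducible_to_simple p e b d ->
  exists F, forall k, (forall g, d 0 g = (k g)%:R) ->
  forall b' i m, matrix_rep e k (complex_vector (std b' i)) m ->
    std b' i = F /\
    forall m', matrix_rep e k (complex_vector (std b' i)) m' -> matrix_equiv e k m m'.
Proof.
elim=> {b d} [b a ab|b d d0 c0 rd [F IH]].
  exists (std b 0) => k dk b' i m rm.
  have kE g : k g = (g == a).
    by apply/eqP; rewrite -(eqr_nat R) -dk simple_rootE.
  have k0 c : e a c -> k c = 0%N.
    by rewrite kE; case: eqP => // ->; rewrite e_irr.
  (* The neighbours of [a] have dimension 0, so the character vanishes at [a]; this forces level 0
     and parity [b]. *)
  have fa : std b' i 0 a = 0.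
    have := matrix_rep_char0 rm _ k0; rewrite kE eqxx => /(_ isT).
    by move/complexI.
  case: i fa rm => [|i] fa rm; last by have := std_gt0S p lam2 y_gt0 b' i a; rewrite fa ltxx.
  have -> : b' = b.
    apply/eqP; apply: contraT => bb; have := std_gt0 lam2 y_gt0 0 (_ : (a < p)%N != b').
    by rewrite ab eq_sym fa ltxx => /(_ bb).
  split=> // m' _; apply: matrix_equiv_orthogonal => x z xz.
  rewrite !kE; case: (eqVneq x a) => [xa|]; last by left.
  by right; case: eqP => // za; rewrite xa za e_irr in xz.
exists (cox (~~ b) F) => k dk b' i m rm.
have [kS kE] := reflect_dimP dk c0.
have dneq0 : d != 0 by apply: (@reducible_neq0 R n p e e_bip b); exact: reducible_step.
(* The excluded character vanishes on parity [b]. It would kill the spaces of the other parity and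
   then, by the sum of dimensions in [kS], those of parity [b], against [d != 0]. *)
have nz : ~~ ((b' == b) && (i == 0%N)).
  apply/negP => /andP[/eqP bb /eqP i0]; rewrite {}bb {}i0 in rm.
  have kz g : ~~ side b g -> k g = 0%N.
    move=> gb; apply: (matrix_rep_dim0 e_sym rm) => [c gc|].
      rewrite /complex_vector std0_eq0 //.
      by have := side_bip b gc; rewrite (negbTE gb) -/(side b c); case: (side b c).
    by rewrite gt_eqF // complex_vector_gt0 std_gt0.
  case/eqP: dneq0; apply/rowP => g; rewrite dk mxE.
  case: (boolP (side b g)) => gb; last by rewrite kz.
  suff : (k g + reflect_dim b k g == 0)%N by rewrite addn_eq0 => /andP[/eqP-> _].
  rewrite kS // big1 // => c gc; apply: kz.
  by have := side_bip b gc; rewrite gb; case: (side b c).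
have fpos g : side b g -> 0 < complex_vector (std b' i) g.
  rewrite complex_vector_gt0 /side => /eqP gb; case: i nz {rm} => [|i] nz.
    by rewrite std_gt0 // gb; move: nz; rewrite andbT eq_sym.
  exact: std_gt0S.
(* With that case excluded, the half [~~ b] lowers the level if [b' = b] and raises it otherwise. *)
have [i2 [b2 fE]] : exists i2 b2, cox (~~ b) (std b' i) = std b2 i2.
  case: (eqVneq b' b) nz => [->|bb] /=.
    by case: i {rm fpos} => // i _; exists i, (~~ b); exact: coxeter_half_stdS.
  have -> : ~~ b = b' by move: bb; case: (b) (b') => [] [].
  by move=> _; exists i.+1, (~~ b'); exact: coxeter_half_std.
have kE' g : ~~ side b g -> reflect_dim b k g = k g.
  by move/negbTE=> gb; rewrite /reflect_dim gb.
have refl m1 : matrix_rep e k (complex_vector (std b' i)) m1 ->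
    exists m2, complementary e (side b) k (reflect_dim b k)
        (complex_vector (std b' i)) m1 m2 /\
      matrix_rep e (reflect_dim b k) (complex_vector (std b2 i2)) m2.
  move=> rm1; have [m2 [cm2 rm2]] :=
    matrix_rep_reflect e_sym (@side_bip b) rm1 kE' kS fpos.
  exists m2; split=> //; apply: eq_matrix_rep rm2 => g.
  by rewrite reflect_character_complex fE.
have [m2 [cm2 rm2]] := refl m rm.
have [FE equiv] := IH _ kE _ _ _ rm2.
split; first by rewrite -FE -fE coxeter_halfK.
move=> m' rm'; have [m2' [cm2' rm2']] := refl m' rm'.
exact: (matrix_equiv_reflect e_sym (@side_bip b) kE' fpos rm rm' rm2 rm2' cm2 cm2' (equiv _ rm2')).
Qed.

End StandardRepresentations.

(** * Passage between matrices and Hilbert space operators *)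

Section Realization.
Variables (R : realType) (n : nat) (e : rel 'I_n).
Local Notation C := (R[i]).

Section OfMatrices.
Variables (k : 'I_n -> nat) (f : 'I_n -> C) (m : 'I_n -> 'I_n -> nat -> nat -> C).
Hypothesis rm : matrix_rep e k f m.

Lemma matrix_representation_adjoint a b : e a b ->
  adjoint_pair (H := euclid_hilbert R (k b)) (K := euclid_hilbert R (k a))
    (euclid_map (nmx (k a) (k b) (m a b))) (euclid_map (nmx (k b) (k a) (m b a))).
Proof. by move=> ab x z; rewrite /= euclid_map_adjoint -(proj1 rm _ _ ab). Qed.

Definition matrix_representation : representation R e :=
  @Representation R n e (fun g => euclid_hilbert R (k g))
    (fun a b => euclid_map (nmx (k a) (k b) (m a b)) :
       {linear euclid R (k b) -> euclid R (k a)})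
    (fun a b _ => euclid_linear_bounded _)
    matrix_representation_adjoint.

Lemma matrix_representation_vertex (g : 'I_n) (x : matrix_representation g) :
  symmetric e -> vertex_operator x = f g *: x.
Proof.
move=> e_sym; rewrite /vertex_operator /= /euclid_map.
under eq_bigr => b gb.
  rewrite -mulmxA -trmx_mul (proj1 rm _ _ gb); over.
by rewrite -mulmx_sumr -raddf_sum /= (proj2 rm) tr_scalar_mx mul_mx_scalar.
Qed.

End OfMatrices.

Lemma matrix_rep_of_representation (pi : representation R e) (f : 'rV[R]_n)
    (k : 'I_n -> nat) (B : forall g, 'I_(k g) -> pi g) :
  symmetric e -> is_character pi f -> (forall g, orthonormal_basis (B g)) ->
  exists m, (forall a b, nmx (k a) (k b) (m a b) = opmx (B b) (B a) (rep_op pi a b)) /\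
    matrix_rep e k (complex_vector f) m.
Proof.
move=> e_sym pif onb.
have /boolp.choice[m0 m0E] : forall ab : 'I_n * 'I_n, exists h,
    nmx (k ab.1) (k ab.2) h = opmx (B ab.2) (B ab.1) (rep_op pi ab.1 ab.2).
  by move=> ab; exact: nmx_onto.
exists (fun a b => m0 (a, b)).
have mE a b : nmx (k a) (k b) (m0 (a, b)) = opmx (B b) (B a) (rep_op pi a b).
  exact: (m0E (a, b)).
split=> //; have adj a b : e a b -> nmx (k b) (k a) (m0 (b, a)) =
    adjmx (nmx (k a) (k b) (m0 (a, b))).
  by move=> ab; rewrite !mE; apply: opmx_adjoint; exact: rep_adjoint.
split=> // g; set S := \sum_(_ | _) _.
have SE (x : pi g) : S *m coords (B g) x = complex_vector f g *: coords (B g) x.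
  rewrite -coordsZ -(proj2 (pif g)) /vertex_operator coords_sum mulmx_suml.
  apply: eq_bigr => b gb; rewrite -adj // !mE.
  by rewrite !(coords_opmx _ _ _ (onb _)) mulmxA.
apply/matrixP => i j; have := SE (from_coords (B g) (delta_mx j 0)).
rewrite from_coordsK // -colE => /colP/(_ i).
by rewrite mxE => ->; rewrite !mxE eqxx andbT mulr_natr.
Qed.

Lemma unitarily_equivalent_of_matrices (pi pi' : representation R e)
    (k : 'I_n -> nat) (m m' : 'I_n -> 'I_n -> nat -> nat -> C)
    (B : forall g, 'I_(k g) -> pi g) (B' : forall g, 'I_(k g) -> pi' g) :
  (forall g, orthonormal_basis (B g)) -> (forall g, orthonormal_basis (B' g)) ->
  (forall a b, nmx (k a) (k b) (m a b) = opmx (B b) (B a) (rep_op pi a b)) ->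
  (forall a b, nmx (k a) (k b) (m' a b) = opmx (B' b) (B' a) (rep_op pi' a b)) ->
  matrix_equiv e k m m' -> unitarily_equivalent pi pi'.
Proof.
move=> onb onb' mE mE' [u [uu ui]].
exists (fun a => matrix_operator (B a) (B' a) (nmx (k a) (k a) (u a))).
split=> [a|a b ab x]; first exact: matrix_operator_unitary.
apply: (can_inj (coordsK (onb' a))).
rewrite (coords_opmx _ _ _ (onb' _)) !coords_matrix_operator //.
by rewrite (coords_opmx _ _ _ (onb _)) !mulmxA -mE -mE' ui.
Qed.

End Realization.

Theorem theorem3p5 (R : realType) (n p : nat) (e : rel 'I_n)
    (p_le_n : (p <= n)%N)
    (e_sym : symmetric e) (e_irr : irreflexive e)
    (e_conn : forall a b : 'I_n, connect e a b)
    (e_bip : forall a b : 'I_n, e a b -> (a < p)%N != (b < p)%N)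
    (ind_ge2 : 2 <= graph_index R e)
    (y : 'rV[R]_n) (y_principal : principal_eigenvector e y)
    (d : 'rV[R]_n) (d_root : is_root e d) (d_singular : singular p e d) :
  (exists (pi : representation R e) (f : 'rV[R]_n),
     standard_representation p y pi f /\ has_dimension pi d) /\
  (forall (pi pi' : representation R e) (f f' : 'rV[R]_n),
     standard_representation p y pi f -> has_dimension pi d ->
     standard_representation p y pi' f' -> has_dimension pi' d ->
     f = f' /\ unitarily_equivalent pi pi').
Proof.
have [y_eq y_gt0] := y_principal.
have y_eigen i : \sum_(k | e i k) y 0 k = graph_index R e * y 0 i.
  have /rowP/(_ i) := y_eq; rewrite !mxE => <-.
  rewrite big_mkcond; apply: eq_bigr => k _; rewrite mxE e_sym.
  by case: (e k i); rewrite ?mulr1 ?mulr0.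
have parity_onto b : exists i : 'I_n, (i < p)%N = b.
  (* The root provides a vertex [a]. As the index and [y] are positive, the eigenvector equation
     forces a neighbour of [a], and it has the other parity. *)
  have [_ [a _]] := d_root.
  have [c ac] : exists c, e a c.
    apply: contrapT => nc; have := y_eigen a.
    rewrite big_pred0 => [/esym/eqP|c]; last by apply/negP => ac; apply: nc; exists c.
    by rewrite gt_eqF // mulr_gt0 // (lt_le_trans _ ind_ge2).
  have := e_bip _ _ ac; case: (eqVneq (a < p)%N b) => [ab _|ab ac_p]; first by exists a.
  by exists c; case: b ab ac_p => /=; case: (a < p)%N; case: (c < p)%N.
have [b rd] := singular_reducible e_sym e_irr e_bip d_root d_singular.
split.
  have [k [m [i [dk rm]]]] :=
    reducible_matrix_rep_exists e_sym e_bip ind_ge2 y_gt0 y_eigen rd.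
  have vE g (x : matrix_representation rm g) := matrix_representation_vertex x e_sym.
  exists (matrix_representation rm), (std p (graph_index R e) y b i).
  split; last by move=> g; exists (k g); split=> //; exact: euclid_hilbert_dim.
  have f0 := std_ge0 p ind_ge2 y_gt0 b i.
  split; last exact: std_standard.
    by move=> g; eexists; split; [exact: (f0 g) | exact: vE].
  by move=> g; split; [exact: f0 | exact: vE].
have [F HF] := reducible_matrix_rep_unique e_sym e_irr e_bip ind_ge2 y_gt0 y_eigen rd.
have of_pi (pi : representation R e) f : standard_representation p y pi f ->
    has_dimension pi d -> forall k, (forall g, d 0 g = (k g)%:R) ->
  exists (B : forall g, 'I_(k g) -> pi g) m b' i, [/\ f = F, F = std p (graph_index R e) y b' i,
    (forall g, orthonormal_basis (B g)),
    (forall a b, nmx (k a) (k b) (m a b) = opmx (B b) (B a) (rep_op pi a b)) &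
    matrix_rep e k (complex_vector F) m].
  move=> [_ pif fst] dim k dk.
  have onb g : exists B : 'I_(k g) -> pi g, orthonormal_basis B.
    have [l [dl ol]] := dim g.
    by have /eqP := dl; rewrite dk eqr_nat => /eqP->.
  pose B g := sval (cid (onb g)).
  have onB g : orthonormal_basis (B g) by exact: (svalP (cid (onb g))).
  have [m [mE rm]] := matrix_rep_of_representation e_sym pif onB.
  (* Characters are nonnegative, so a standard one lies in the family [std]. *)
  have [b' [i fE]] := standard_nonneg_std e_bip ind_ge2 y_gt0 y_eigen parity_onto
    fst (fun g => proj1 (pif g)).
  rewrite fE in rm; have [FE _] := HF k dk b' i m rm.
  by exists B, m, b', i; rewrite -FE.
move=> pi pi' f f' st dim st' dim'.
(* The natural dimensions are read off [pi] and serve [pi'] too, since [d] is shared. *)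
have /boolp.choice[k dk] g : exists k : nat, d 0 g = k%:R.
  by have [k [? _]] := dim g; exists k.
have [B [m [b' [i [-> FE onB mE rm]]]]] := of_pi _ _ st dim k dk.
have [B' [m' [_ [_ [-> _ onB' mE' rm']]]]] := of_pi _ _ st' dim' k dk.
split=> //; apply: unitarily_equivalent_of_matrices onB onB' mE mE' _.
by rewrite FE in rm rm'; have [_] := HF k dk b' i m rm; apply.
Qed.
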